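(* Let $\omega$ be irrational and consider the rotation $\theta\mapsto\theta+\omega$ on $\mathbb T^1=\mathbb R/\mathbb Z$. There exist Cantor sets $C,C'\subseteq\mathbb T^1$ of positive Lebesgue measure such that $S_C=[0,\mathrm{Leb}_{\mathbb T^1}(C)]$, and such that $S_{C'}$ has a gap at $0$; in particular, $\{0,\mathrm{Leb}_{\mathbb T^1}(C')\}\subseteq S_{C'}\subsetneq[0,\mathrm{Leb}_{\mathbb T^1}(C')]$.
   Context: For $C\subseteq\mathbb T^1$, $\theta\in\mathbb T^1$ and $n\in\mathbb N=\{1,2,\ldots\}$ put $S_C^n(\theta)=\frac1n\sum_{i=0}^{n-1}\mathbf 1_C(\theta+i\omega)$, and let $$S_C=\bigcup_{\theta\in\mathbb T^1}\ \bigcap_{N\in\mathbb N}\overline{\{S^n_C(\theta)\colon n\ge N\}}$$ be the Birkhoff spectrum of $C$. A Cantor set is a non-empty compact, totally disconnected set without isolated points. ''$S_{C'}$ has a gap at $0$'' means that $0$ is an isolated point of $S_{C'}$, i.e. there is $\varepsilon>0$ with $S_{C'}\cap(0,\varepsilon)=\emptyset$. $\mathrm{Leb}_{\mathbb T^1}$ is normalised Lebesgue measure. *)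

(* Defs.v *)
From HB Require Import structures.
From mathcomp Require Import all_boot all_order all_algebra.
From mathcomp Require Import all_classical all_reals all_analysis.
From mathcomp Require Import measurable_realfun.

Set Implicit Arguments.
Unset Strict Implicit.
Unset Printing Implicit Defensive.

Import Order.TTheory GRing.Theory Num.Theory.
Import numFieldNormedType.Exports.

Local Open Scope classical_set_scope.
Local Open Scope quotient_scope.
Local Open Scope ring_scope.

Section circle.
Variable R : realType.

Definition congr_Z (x y : R) := x - y \is a Num.int.

Lemma congr_Z_refl : reflexive congr_Z.
Proof. by move=> x; rewrite /congr_Z subrr rpred0. Qed.

Lemma congr_Z_sym : symmetric congr_Z.
Proof. by move=> x y; rewrite /congr_Z -rpredN opprB. Qed.

Lemma congr_Z_trans : transitive congr_Z.
Proof.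
by move=> y x z xy yz; rewrite /congr_Z -(subrK y x) -addrA; exact: rpredD.
Qed.

Canonical congr_Z_equiv :=
  EquivRel congr_Z congr_Z_refl congr_Z_sym congr_Z_trans.

(* R / Z, with the quotient topology, the quotient group structure and the
   Borel sigma-algebra. *)
Definition circle : Type := {eq_quot congr_Z_equiv}.

HB.instance Definition _ := Topological.copy circle
  (quotient_topology {eq_quot congr_Z_equiv}).
HB.instance Definition _ := Quotient.on circle.
HB.instance Definition _ := Pointed.copy circle
  (quotient_topology {eq_quot congr_Z_equiv}).

Lemma circle_eqP (x y : R) :
  reflect (\pi_circle x = \pi_circle y) (x - y \is a Num.int).
Proof. exact: (iffP (@eqmodP _ congr_Z_equiv x y)). Qed.

Lemma circle_repr_int (x : R) : repr (\pi_circle x) - x \is a Num.int.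
Proof. by apply/circle_eqP; rewrite reprK. Qed.

Definition circle_add (a b : circle) : circle := \pi_circle (repr a + repr b).
Definition circle_opp (a : circle) : circle := \pi_circle (- repr a).

Lemma circle_addE (x y : R) :
  circle_add (\pi_circle x) (\pi_circle y) = \pi_circle (x + y).
Proof.
apply/circle_eqP; rewrite opprD addrACA.
by apply: rpredD; exact: circle_repr_int.
Qed.

Lemma circle_oppE (x : R) : circle_opp (\pi_circle x) = \pi_circle (- x).
Proof. by apply/circle_eqP; rewrite -opprD rpredN circle_repr_int. Qed.

Lemma circle_addA : associative circle_add.
Proof.
elim/quotW=> x; elim/quotW=> y; elim/quotW=> z.
by rewrite (circle_addE y z) (circle_addE x y) 2!circle_addE addrA.
Qed.

Lemma circle_addC : commutative circle_add.
Proof. by move=> a b; rewrite /circle_add (addrC (repr a)). Qed.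

Lemma circle_add0 : left_id (\pi_circle 0) circle_add.
Proof. by elim/quotW=> x; rewrite circle_addE add0r. Qed.

Lemma circle_addN : left_inverse (\pi_circle 0) circle_opp circle_add.
Proof. by elim/quotW=> x; rewrite circle_oppE circle_addE addNr. Qed.

HB.instance Definition _ :=
  GRing.isZmodule.Build circle circle_addA circle_addC circle_add0 circle_addN.

Definition circle_display : measure_display := sigma_display (@open circle).

HB.instance Definition _ := @isMeasurable.Build circle_display circle
  <<s @open circle >> (@sigma_algebra0 _ setT _) (@sigma_algebraC _ _)
  (@sigma_algebra_bigcup _ setT _).

Definition to_circle (x : measurableTypeR R) : circle := \pi_circle x.

Lemma measurable_to_circle : measurable_fun setT to_circle.
Proof.
apply: (@measurability _ _ _ _ setT to_circle (@open circle)) => //.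
move=> _ [U oU <-]; rewrite setTI; exact: open_measurable.
Qed.

HB.instance Definition _ :=
  isMeasurableFun.Build _ _ _ _ to_circle measurable_to_circle.

(* The half-open interval [0, 1) is a fundamental domain of R / Z, so the total
   mass is 1, see circle_leb_setT. *)
Definition circle_leb : set circle -> \bar R :=
  pushforward (mrestr lebesgue_measure (measurable_itv `[0%R, 1%R[)) to_circle.

Let circle_leb0 : circle_leb set0 = 0%E.
Proof. by rewrite /circle_leb /pushforward preimage_set0 measure0. Qed.

Let circle_leb_ge0 (A : set circle) : (0 <= circle_leb A)%E.
Proof. exact: measure_ge0. Qed.

Let circle_leb_sigma_additive : semi_sigma_additive circle_leb.
Proof.
move=> F mF tF mUF; rewrite /circle_leb /pushforward preimage_bigcup.
apply: measure_semi_sigma_additive.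
- by move=> n; rewrite -[X in measurable X]setTI; exact: measurable_to_circle.
- apply/trivIsetP => /= i j _ _ ij; rewrite -preimage_setI.
  by move/trivIsetP : tF => /(_ _ _ _ _ ij) ->//; rewrite preimage_set0.
- rewrite -preimage_bigcup -[X in measurable X]setTI.
  exact: measurable_to_circle.
Qed.

HB.instance Definition _ := isMeasure.Build _ _ _ circle_leb
  circle_leb0 circle_leb_ge0 circle_leb_sigma_additive.

Lemma circle_leb_setT : circle_leb setT = 1%E.
Proof.
rewrite /circle_leb /pushforward /mrestr preimage_setT setTI.
by rewrite lebesgue_measure_itv/= lte01 oppr0 adde0.
Qed.

HB.instance Definition _ :=
  Measure_isProbability.Build _ _ _ circle_leb circle_leb_setT.

End circle.

Definition cantor_set (T : topologicalType) (C : set T) :=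
  [/\ C !=set0, compact C, totally_disconnected C & isolated C = set0].

Section birkhoff.
Variables (R : realType) (omega : R).

Definition birkhoff_avg (C : set (circle R)) (n : nat) (theta : circle R) : R :=
  n%:R^-1 * \sum_(i < n) \1_C (theta + \pi_(circle R) omega *+ i).

Definition birkhoff_spectrum (C : set (circle R)) : set R :=
  \bigcup_(theta in [set: circle R]) \bigcap_(N in [set N | (0 < N)%N])
    closure [set birkhoff_avg C n theta | n in [set n | (N <= n)%N]].

End birkhoff.

(* Main.v *)
Require Import Defs.
From mathcomp Require Import all_boot all_order all_algebra.
From mathcomp Require Import all_classical all_reals all_analysis.
From mathcomp Require Import measurable_realfun ring lra zify.
Import Order.TTheory GRing.Theory Num.Theory.
Import numFieldNormedType.Exports.
Local Open Scope classical_set_scope.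
Local Open Scope ring_scope.

Set Implicit Arguments.
Unset Strict Implicit.
Unset Printing Implicit Defensive.

(** Both sets are complements of unions of very thin open arcs placed along
the orbit of 0.  Fix heights h_0 < h_1 < ... and radii a_0 > a_1 > ... such
that an orbit which comes within a_k of 0 needs more than 4^(k+6) h_k steps to
come as close again.  A tower of level k consists of the arcs of radius a_k
about the points z omega, for z in a window of at most 2^k h_k consecutive
integers.  An orbit is in it during runs, one for each time l at which it is
within a_k of 0, and the runs are short compared with the gaps between them:
from the first gap on, the tower is visited with frequency at most 2^-k, up to
a constant.

The first set C avoids all towers, with windows [h_k, 2^k h_k).  The point 0
runs through every tower at its own time: at time 2^k h_k it has been in C for
at most h_k steps, so its averages come close to 0.  But at time h_J it has met
only levels below J, the levels from K on have been visited with frequency at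
most 2^-K, and the levels below K form a finite union of arcs, which is visited
with frequency close to its measure (good_visits, forward_tail); so the
averages also come close to Leb C.  As consecutive averages differ by O(1/n),
the limit points of the averages along this one orbit fill [0, Leb C]
(clusters_between).  No orbit exceeds Leb C, because closed sets are visited
with upper frequency at most their measure (closed_visits).

The second set C' consists of the points lying in at most one tower, now with
windows [-h_k, 0), so that every run ends close to 0, and with h_{k+1} omega
within a_k / 2 of 0.  Thus a run of level k' also starts close to 0, namely
within a_j of 0 for every j < k'; hence a run of a lower level j which overlaps
it ends at least 4^(j+6) h_j steps after that start.  This gives a dichotomy
for each orbit (backward_gap).  If for every M some run covers the whole of
[0, M), then runs of two different levels do, the orbit never meets C', and its
averages tend to 0.  Otherwise, from some time M on, all runs began after time
0, the time spent in two towers is at most a quarter of the whole, and every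
limit point of the averages is at least 1/2.  Orbits of the first kind exist by
the Baire category theorem.  The orbit of 0 is of the second kind, and
Leb C' is a limit point of its averages.

Both complements are open and dense, so the sets are compact and totally
disconnected.  They have no isolated points because the radii are rational: a
left endpoint of an arc never meets a right endpoint on the circle, so those of
the levels up to K are 2 rho_K apart for some rho_K > 0, and the later towers
are chosen with total measure less than rho_K.  Near a point of the set, at
least one side of length rho_K is then not blocked (good_perfect). *)

(** * Distance to the integers *)

Section distance_to_int.
Variable R : realType.
Implicit Types a b x y : R.

Definition nearZ a x : Prop := exists m : int, `|x - m%:~R| < a.

Lemma nearZ_le a b x : a <= b -> nearZ a x -> nearZ b x.
Proof. by move=> ab [m xm]; exists m; exact: lt_le_trans xm ab. Qed.

Lemma nearZ_min a b x : nearZ (Num.min a b) x -> nearZ a x /\ nearZ b x.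
Proof. by move=> abx; split; apply: nearZ_le abx; rewrite ge_min lexx ?orbT. Qed.

Lemma nearZN a x : nearZ a x -> nearZ a (- x).
Proof. by move=> [m xm]; exists (- m); rewrite mulrNz -opprD normrN. Qed.

Lemma nearZD a b x y : nearZ a x -> nearZ b y -> nearZ (a + b) (x + y).
Proof.
move=> [m xm] [n yn]; exists (m + n); rewrite intrD opprD addrACA.
by apply: le_lt_trans (ler_normD _ _) _; exact: ltrD.
Qed.

Lemma nearZ_int a x (m : int) : nearZ a (x + m%:~R) <-> nearZ a x.
Proof.
split=> [[n xn]|[n xn]].
  by exists (n - m); rewrite intrB opprB [m%:~R - _]addrC addrA addrAC.
by exists (n + m); rewrite intrD opprD addrACA subrr addr0.
Qed.

Lemma floor_dist_min x (m : int) :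
  Num.min (x - (Num.floor x)%:~R) ((Num.floor x + 1)%:~R - x) <= `|x - m%:~R|.
Proof.
have /andP[x0 x1] := floor_itv x; rewrite ge_min; apply/orP.
have [mx|xm] := leP m (Num.floor x); [left|right].
  have : m%:~R <= (Num.floor x)%:~R :> R by rewrite ler_int.
  by have := ler_norm (x - m%:~R); lra.
have : (Num.floor x + 1)%:~R <= m%:~R :> R by rewrite ler_int lezD1.
by have := ler_norm (- (x - m%:~R)); rewrite normrN; lra.
Qed.

Lemma nonint_separated x : x \isn't a Num.int -> exists2 c, 0 < c & ~ nearZ c x.
Proof.
move=> xNint; have /andP[x0 x1] := floor_itv x.
exists (Num.min (x - (Num.floor x)%:~R) ((Num.floor x + 1)%:~R - x)).
  by rewrite lt_min !subr_gt0 x1 lt_neqAle x0 -intrEfloor xNint.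
by move=> [m]; apply/negP; rewrite -leNgt floor_dist_min.
Qed.

(** The nearer of the two integers around x is at distance exactly a. *)
Lemma nearZ_boundary a x :
  (forall b, a < b -> nearZ b x) -> ~ nearZ a x ->
  exists m : int, x = m%:~R + a \/ x = m%:~R - a.
Proof.
move=> nearb nneara; pose f := Num.floor x.
have af : a <= `|x - f%:~R| by rewrite leNgt; apply/negP => ?; apply: nneara; exists f.
have af1 : a <= `|x - (f + 1)%:~R|.
  by rewrite leNgt; apply/negP => ?; apply: nneara; exists (f + 1).
have /andP[x0 x1] := floor_itv x; rewrite -/f in x0 x1.
rewrite ger0_norm ?subr_ge0// in af.
rewrite ler0_norm ?opprB in af1; last by rewrite subr_le0 ltW.
have : Num.min (x - f%:~R) ((f + 1)%:~R - x) <= a.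
  rewrite leNgt; apply/negP => /nearb[m]; apply/negP.
  by rewrite -leNgt floor_dist_min.
by rewrite ge_min => /orP[fa|fa]; [exists f; left|exists (f + 1); right]; lra.
Qed.

End distance_to_int.

(** * Multiples of an irrational number *)

Section irrational_rotation.
Variables (R : realType) (omega : R).
Hypothesis omega_irr : irrational omega.

Lemma multiple_nonint q : (0 < q)%N -> q%:R * omega \isn't a Num.int.
Proof.
move=> q0; apply/negP => /intrP[m qm]; apply: omega_irr.
apply/rationalP; exists m, q; rewrite -qm mulrAC mulfV ?mul1r//.
by rewrite pnatr_eq0 -lt0n.
Qed.

Lemma multiples_separated N :
  exists2 c, 0 < c & forall q, (0 < q <= N)%N -> ~ nearZ c (q%:R * omega).
Proof.
elim: N => [|N [c c0 cN]]; first by exists 1 => // -[].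
have [d d0 dN] := nonint_separated (multiple_nonint (ltn0Sn N)).
exists (Num.min c d) => [|q]; first by rewrite lt_min c0.
case/andP=> q0; rewrite leq_eqVlt => /predU1P[->|qN].
  by case/nearZ_min.
by case/nearZ_min => + _; apply: cN; rewrite q0.
Qed.

(** Pigeonhole on the fractional parts of the first N + 1 multiples of omega. *)
Lemma dirichlet e : 0 < e -> exists2 q, (0 < q)%N & nearZ e (q%:R * omega).
Proof.
move=> e0; pose N := (Num.truncn e^-1).+1.
have N0 : 0 < N%:R :> R by rewrite ltr0n.
have Ne : N%:R^-1 < e.
  by rewrite invf_plt// truncnS_gt.
pose fr (i : 'I_N.+1) := i%:R * omega - (Num.floor (i%:R * omega))%:~R.
have fr01 i : 0 <= fr i < 1.
  by rewrite /fr subr_ge0 floor_le ltrBlDl -intrD1 floorD1_gt.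
have frN i : (Num.truncn (N%:R * fr i) < N)%N.
  have /andP[f0 f1] := fr01 i.
  rewrite truncn_lt_nat ?mulr_ge0 ?(ltW N0)//.
  by rewrite -[ltRHS]mulr1 ltr_pM2l.
pose f i := Ordinal (frN i).
have : ~~ injectiveb f.
  by apply/injectiveP => /leq_card; rewrite !card_ord ltnn.
case/injectivePn => i [j ij /(congr1 val)/= fij].
have close k l : Num.truncn (N%:R * fr k) = Num.truncn (N%:R * fr l) ->
    fr k - fr l < e.
  move=> kl; apply: lt_trans Ne; rewrite -(ltr_pM2l N0) mulfV ?gt_eqF// mulrBr.
  have Nfr_ge0 i0 : 0 <= N%:R * fr i0.
    by apply: mulr_ge0; [exact: ltW|case/andP: (fr01 i0)].
  have := truncn_itv (Nfr_ge0 k); have := truncn_itv (Nfr_ge0 l).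
  rewrite kl -natr1.
  by move: (N%:R * _) (N%:R * _) ((Num.truncn _)%:R) => x y n; lra.
have main (k l : 'I_N.+1) : (l < k)%N ->
    Num.truncn (N%:R * fr k) = Num.truncn (N%:R * fr l) ->
    exists2 q, (0 < q)%N & nearZ e (q%:R * omega).
  move=> lk kl; exists (k - l)%N; first by rewrite subn_gt0.
  exists (Num.floor (k%:R * omega) - Num.floor (l%:R * omega)).
  rewrite (_ : _ - _ = fr k - fr l); last first.
    by rewrite /fr natrB ?(ltnW lk)// intrB; ring.
  by rewrite ltr_norml close// andbT ltrNl opprB close.
move: ij; rewrite -val_eqE neq_ltn => /orP[ij|ij]; last exact: main ij _.
exact: main ij (esym _).
Qed.

(** The multiples of index at most Q stay away from the integers, so a better
approximation has a larger index. *)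
Lemma dirichlet_large e Q : 0 < e ->
  exists2 q, (Q < q)%N & nearZ e (q%:R * omega).
Proof.
move=> e0; have [c c0 cQ] := multiples_separated Q.
have [|q q0 qe] := @dirichlet (Num.min e c); first by rewrite lt_min e0.
have [{}qe qc] := nearZ_min qe; exists q => //.
by rewrite ltnNge; apply/negP => qQ; apply: (cQ q); rewrite ?q0.
Qed.

(** A multiple of omega that is close to an integer moves points by a small
step d on the circle; repeating the step, in the direction given by the sign of
d, comes close to every point. *)
Lemma orbit_dense x e : 0 < e -> exists n : nat, nearZ e (x - n%:R * omega).
Proof.
move=> e0; have [q q0 [m qm]] := dirichlet e0.
set d := q%:R * omega - m%:~R in qm.
have d0 : d != 0.
  apply/eqP => /subr0_eq qm0; move: (multiple_nonint q0).
  by rewrite qm0 intr_int.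
have /andP[f0 f1] := floor_itv x; rewrite intrD in f1.
have [dp|dn] := ltP 0 d.
  pose j := Num.truncn ((x - (Num.floor x)%:~R) / d).
  have : j%:R <= (x - (Num.floor x)%:~R) / d < j.+1%:R.
    by apply: truncn_itv; apply: divr_ge0; lra.
  rewrite ler_pdivlMr// ltr_pdivrMr// -natr1 mulrDl mul1r.
  rewrite gtr0_norm// in qm.
  exists (j * q)%N, (Num.floor x - j%:Z * m).
  rewrite intrB intrM natrM -[j%:Z%:~R]/(j%:R).
  rewrite (_ : x - _ - _ = (x - (Num.floor x)%:~R) - j%:R * d); last first.
    by rewrite /d; ring.
  rewrite ltr_norml; lra.
have {d0 dn}dn : d < 0 by rewrite lt_neqAle d0.
pose j := Num.truncn (((Num.floor x)%:~R + 1 - x) / - d).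
have : j%:R <= ((Num.floor x)%:~R + 1 - x) / - d < j.+1%:R.
  by apply: truncn_itv; apply: divr_ge0; lra.
rewrite ler_pdivlMr ?oppr_gt0// ltr_pdivrMr ?oppr_gt0// -natr1 mulrDl mul1r.
rewrite ltr0_norm// in qm.
exists (j * q)%N, (Num.floor x + 1 - j%:Z * m).
rewrite intrB intrD intrM natrM -[j%:Z%:~R]/(j%:R).
rewrite (_ : x - _ - _ = - ((Num.floor x)%:~R + 1 - x) - j%:R * d); last first.
  by rewrite /d; ring.
rewrite ltr_norml; lra.
Qed.

End irrational_rotation.

(** * Heights and radii *)

Section scales.
Variables (R : realType) (omega : R).

(** The towers of level k will have at most 2^k hgt k floors, arcs of radius
rad k.  By rad_return an orbit comes back to the same floor so slowly that it
spends only a fraction of order 2^-k of its time in the tower.  By hgt_near the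
time hgt k.+1 is almost a return of level k, which aligns the runs of different
levels.  The room rho k between endpoints of opposite kind of arcs of level at
most k, and massS, which keeps the later towers small compared with it, serve to
exclude isolated points. *)
Record scales := Scales {
  hgt : nat -> nat;
  den : nat -> nat;
  rad := fun k => (den k)%:R^-1 : R;
  rho : nat -> R;
  hgt_gt0 : forall k, (0 < hgt k)%N;
  hgt_grow : forall k, (4 ^ (k + 3) * hgt k <= hgt k.+1)%N;
  hgt_near : forall k, nearZ (rad k / 2) ((hgt k.+1)%:R * omega);
  den_gt4 : forall k, (4 < den k)%N;
  rad_half : forall k, rad k.+1 <= rad k / 2;
  rad_return : forall k q, (0 < q <= 4 ^ (k + 6) * hgt k)%N ->
    ~ nearZ (2 * rad k) (q%:R * omega);
  rho_gt0 : forall k, 0 < rho k;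
  rho_le1 : forall k, rho k <= 2^-1;
  rho_half : forall k, rho k.+1 <= rho k / 2;
  rho_sep : forall k i i' (j m : int), (i <= k)%N -> (i' <= k)%N ->
    (`|j| <= 2 * (2 ^ k * hgt k))%N ->
    2 * rho k <= `|j%:~R * omega - (rad i + rad i') - m%:~R|;
  mass0 : 6 * ((hgt 0)%:R * rad 0) <= 2^-1 ^+ 2;
  massS : forall k, 6 * ((2 ^ k.+1 * hgt k.+1)%:R * rad k.+1) <=
    rho k * 2^-1 ^+ k.+3 }.

Hypothesis omega_irr : irrational omega.

Lemma small_inv (e : R) (n : nat) : 0 < e -> exists2 c, (n < c)%N & c%:R^-1 <= e.
Proof.
move=> e0; exists (n + (Num.truncn e^-1).+1)%N; first by rewrite addnS ltnS leq_addr.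
rewrite invf_ple ?posrE ?ltr0n ?addnS//; apply: le_trans (ltW (truncnS_gt _)) _.
by rewrite ler_nat ltnS leq_addl.
Qed.

(** All radii of level at most k are multiples of 1 / den k, so den k times the
quantity in rho_sep is a nonzero integer if j = 0, and otherwise at least the
distance to the integers of a nonzero multiple of omega of bounded index.  Hence
rho k depends only on hgt k and den k, and hgt (k + 1), then den (k + 1), can be
chosen after it. *)
Lemma scales_exist : inhabited scales.
Proof.
have [sep sepP] : exists sep : nat -> R, forall N, 0 < sep N /\
    forall q, (0 < q <= N)%N -> ~ nearZ (sep N) (q%:R * omega).
  have /choice[sep sepP] : forall N, exists c, 0 < c /\
      forall q, (0 < q <= N)%N -> ~ nearZ c (q%:R * omega).
    by move=> N; have [c] := multiples_separated omega_irr N; exists c.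
  by exists sep.
have sep_gt0 N : 0 < sep N by case: (sepP N).
(* the value chosen for rho k when level k has height h and denominator b *)
pose r (k h b : nat) : R := Num.min 1 (sep (b * (2 * (2 ^ k * h)))%N) / (2 * b%:R).
have r0 k h b : (0 < b)%N -> 0 < r k h b.
  by move=> b0; rewrite divr_gt0 ?lt_min ?ltr01 ?sep_gt0// mulr_gt0 ?ltr0n.
have rle k h b : (0 < b)%N -> r k h b <= b%:R^-1 / 2.
  move=> b0; rewrite /r -[leRHS]mul1r -invfM [b%:R * _]mulrC ler_pM2r.
    by rewrite ge_min lexx.
  by rewrite invr_gt0 mulr_gt0 ?ltr0n.
pose good (k h b h' b' : nat) := [/\ (4 ^ (k + 3) * h < h')%N,
  nearZ (b%:R^-1 / 2) (h'%:R * omega), (b %| b')%N /\ (b * 2 <= b')%N,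
  2 * b'%:R^-1 <= sep (4 ^ (k.+1 + 6) * h')%N &
  6 * ((2 ^ k.+1 * h')%:R * b'%:R^-1) <= r k h b * 2^-1 ^+ k.+3].
have /choice[f fP] : forall x : nat * (nat * nat), exists y : nat * nat,
    (0 < x.2.2)%N -> good x.1 x.2.1 x.2.2 y.1 y.2.
  move=> [k [h b]] /=; case: (posnP b) => [->|b0]; first by exists (0, 0)%N.
  have e0 : 0 < b%:R^-1 / 2 :> R by rewrite divr_gt0 ?invr_gt0 ?ltr0n.
  have [h' hh' h'near] := dirichlet_large omega_irr (4 ^ (k + 3) * h)%N e0.
  have M0 : 0 < 6 * (2 ^ k.+1 * h')%:R :> R.
    by rewrite mulr_gt0// ltr0n muln_gt0 expn_gt0/=; exact: leq_ltn_trans hh'.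
  pose e := Num.min (sep (4 ^ (k.+1 + 6) * h')%N / 2)
                    ((r k h b * 2^-1 ^+ k.+3) / (6 * (2 ^ k.+1 * h')%:R)).
  have {}e0 : 0 < e.
    by rewrite lt_min !divr_gt0// mulr_gt0 ?r0// exprn_gt0 ?invr_gt0.
  have [c c1 ce] := small_inv 1 e0; exists (h', b * c)%N => _ /=.
  have bce : (b * c)%:R^-1 <= e.
    apply: le_trans ce; rewrite lef_pV2 ?posrE ?ltr0n ?muln_gt0 ?b0 ?(ltnW c1)//.
    by rewrite ler_nat leq_pmull.
  split => //; first by rewrite dvdn_mulr// leq_pmul2l.
    by move: bce; rewrite le_min ler_pdivlMr// mulrC => /andP[].
  rewrite mulrA mulrC -ler_pdivlMr//.
  by move: bce; rewrite le_min => /andP[].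
(* 24 makes 6 / b0 at most 1 / 4, as mass0 demands for height 1 *)
have [b0 b00 b0e] := @small_inv (Num.min (sep (4 ^ (0 + 6) * 1)%N / 2) (24^-1)) 4
  ltac:(by rewrite lt_min divr_gt0 ?sep_gt0//= invr_gt0).
move: b0e; rewrite le_min => /andP[b0sep b0mass].
pose s n : nat * nat :=
  nat_rect (fun=> (nat * nat)%type) (1, b0)%N (fun k x => f (k, x)) n.
pose h k := (s k).1; pose b k := (s k).2.
have b4 k : (4 < b k)%N.
  elim: k => [//|k b4]; have [_ _ [_ +] _ _] := fP (k, s k) (leq_trans (ltn0Sn 4) b4).
  rewrite -[(f _).2]/(b k.+1) -[(k, s k).2.2]/(b k); apply: leq_trans.
  by rewrite (leq_trans b4)// leq_pmulr.
have b_gt0 k : (0 < b k)%N by apply: leq_trans (b4 k).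
have sgood k : good k (h k) (b k) (h k.+1) (b k.+1) by exact: fP (k, s k) (b_gt0 k).
have bdvd i k : (i <= k)%N -> (b i %| b k)%N.
  elim: k => [|k IH]; first by rewrite leqn0 => /eqP ->.
  rewrite leq_eqVlt => /predU1P[-> //|]; rewrite ltnS => /IH /dvdn_trans; apply.
  by have [_ _ [? _] _ _] := sgood k.
have h_gt0 k : (0 < h k)%N.
  by case: k => [//|k]; have [+ _ _ _ _] := sgood k; exact: leq_ltn_trans.
unshelve refine (inhabits (@Scales h b (fun k => r k (h k) (b k))
  _ _ _ _ _ _ _ _ _ _ _ _)) => //.
- by move=> k; have [/ltnW] := sgood k.
- by move=> k; have [] := sgood k.
- move=> k; have [_ _ [_ bb] _ _] := sgood k.
  by rewrite -invfM lef_pV2 ?posrE ?ltr0n ?mulr_gt0 ?ltr0n// -natrM ler_nat.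
- have sepk k : 2 * (b k)%:R^-1 <= sep (4 ^ (k + 6) * h k)%N.
    case: k => [|k]; last by have [] := sgood k.
    by move: b0sep; rewrite ler_pdivlMr// mulrC.
  by move=> k q qh /(nearZ_le (sepk k)); case: (sepP (4 ^ (k + 6) * h k)%N) => _; apply.
- by move=> k; exact: r0.
- move=> k; apply: le_trans (rle _ _ _ (b_gt0 k)) _.
  rewrite ler_pdivrMr// mulVf// invf_le1 ?ltr0n// ler1n//.
- move=> k; apply: le_trans (rle _ _ _ (b_gt0 k.+1)) _.
  have [_ _ [_ bb] s' m'] := sgood k.
  rewrite ler_pM2r ?invr_gt0//.
  have a0 : 0 <= (b k.+1)%:R^-1 :> R by rewrite invr_ge0.
  apply: (@le_trans _ _ (6 * ((2 ^ k.+1 * h k.+1)%:R * (b k.+1)%:R^-1))).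
    rewrite mulrA ler_peMl// -natrM ler1n.
    by rewrite !muln_gt0 expn_gt0 h_gt0.
  apply: le_trans m' _; rewrite ler_piMr ?(ltW (r0 _ _ _ _))//.
  by rewrite exprn_ile1 ?invr_ge0// invf_le1// ler1n.
- move=> k i i' j m ik i'k jk.
  have [p pE /andP[p0 pb]] : exists2 p : nat,
      (b k)%:R * ((b i)%:R^-1 + (b i')%:R^-1) = p%:R :> R & (0 < p < b k)%N.
    have [/dvdnP[c cE] /dvdnP[c' c'E]] := (bdvd _ _ ik, bdvd _ _ i'k).
    exists (c + c')%N.
      by rewrite mulrDr {1}cE c'E !natrM natrD !mulfK ?pnatr_eq0 -?lt0n.
    have := b4 i; have := b4 i'; have := b_gt0 k; nia.
  have b0R : 0 < (b k)%:R :> R by rewrite ltr0n.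
  rewrite /r mulrA [2 * _]mulrC -mulrA invfM mulVKf// ler_pdivrMr//.
  set X := (X in _ <= `|X| * _).
  rewrite -(gtr0_norm b0R) -normrM.
  rewrite (_ : X * _ =
    (b k)%:R * j%:~R * omega - (p%:Z + (b k)%:Z * m)%:~R); last first.
    by rewrite intrD intrM -![_%:Z%:~R]/(_%:R) -pE /X; ring.
  have [->|j0] := eqVneq j 0.
    rewrite mulr0 mul0r sub0r normrN ge_min norm_intr_ge1 ?intr_int//.
    rewrite intr_eq0; apply/eqP => pbm; have [m0|m0] := lerP 0 m; nia.
  have [_ /(_ (b k * `|j|)%N)] := sepP (b k * (2 * (2 ^ k * h k)))%N.
  rewrite muln_gt0 b_gt0 absz_gt0 j0 leq_mul2l jk orbT => /(_ isT) sepj.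
  rewrite leNgt; apply/negP; rewrite lt_min => /andP[_ jsep]; apply: sepj.
  have {jsep} : nearZ (sep (b k * (2 * (2 ^ k * h k)))%N) ((b k)%:R * j%:~R * omega).
    by eexists; exact: jsep.
  case: (intP j) => [|j'|j'] => [|//|/nearZN].
  - by rewrite absz0 muln0 mulr0.
  - by rewrite absz_nat natrM.
  - by rewrite abszN absz_nat natrM mulrNz mulrN mulNr opprK.
- rewrite /= mul1r; move: b0mass; rewrite -[b 0]/b0; lra.
- by move=> k; have [] := sgood k.
Qed.

End scales.

(** * Counting visits *)

Section counting.
Local Open Scope nat_scope.
Implicit Types (P Q L : nat -> Prop) (n m : nat).

Definition hits P n : nat := \sum_(i < n) `[< P i >].

Lemma hits_le P Q n : (forall i, i < n -> P i -> Q i) -> hits P n <= hits Q n.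
Proof.
move=> PQ; apply: leq_sum => i _; case: (asboolP (P i)) => // /PQ -/(_ (ltn_ord i)) Qi.
by rewrite asboolT.
Qed.

Lemma hits_cover P (Q : nat -> nat -> Prop) n m :
  (forall i, i < n -> P i -> exists2 k, k < m & Q k i) ->
  hits P n <= \sum_(k < m) hits (Q k) n.
Proof.
move=> PQ; rewrite /hits exchange_big/=; apply: leq_sum => i _.
case: (asboolP (P i)) => // /PQ -/(_ (ltn_ord i))[k km Qki].
by rewrite (bigD1 (Ordinal km))//= asboolT.
Qed.

Lemma hitsU P Q n : hits (fun i => P i \/ Q i) n <= hits P n + hits Q n.
Proof.
rewrite /hits -big_split/=; apply: leq_sum => i _.
by rewrite asbool_or; case: `[<P i>]; case: `[<Q i>].
Qed.

Lemma hitsC P n : hits (fun i => ~ P i) n = n - hits P n.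
Proof.
suff : hits P n + hits (fun i => ~ P i) n = n by lia.
rewrite /hits -big_split/= -[RHS]card_ord -sum1_card; apply: eq_bigr => i _.
by rewrite asbool_neg; case: `[<P i>].
Qed.

Lemma hits_le_time P n : hits P n <= n.
Proof.
rewrite -[leqRHS]card_ord -sum1_card; apply: leq_sum => i _.
by case: `[<P i>].
Qed.

Lemma hits_none P m n : m <= n -> (forall i, m <= i < n -> ~ P i) ->
  hits P n = hits P m.
Proof.
move=> mn; rewrite -(subnKC mn); elim: (n - m) => [|d IH] nP; first by rewrite addn0.
rewrite addnS [LHS]big_ord_recr/= asboolF ?addn0; last by apply: nP; lia.
by apply: IH => i id; apply: nP; lia.
Qed.

Lemma hits_interval a b n : hits (fun i => a <= i < b) n <= b - a.
Proof.
apply: (@leq_trans (minn n b - a)); last by lia.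
elim: n => [|n IH]; first by rewrite /hits big_ord0.
rewrite /hits big_ord_recr/=; move: IH; rewrite /hits; set s := (\sum_(i < n) _).
by move=> IH; case: asboolP => [abn|_] /=; lia.
Qed.

(** Each element of L owns the q integers ending at it; these blocks are
disjoint and contained in [1, n). *)
Lemma hits_separated L q n : 0 < q -> (forall l, L l -> q <= l) ->
  (forall l l', L l -> L l' -> l < l' -> q <= l' - l) -> hits L n * q <= n.-1.
Proof.
move=> q0 Lq Lsep; elim/ltn_ind: n => -[|n] IH; first by rewrite /hits big_ord0.
have [Ln|nLn] := pselect (L n); last first.
  rewrite (@hits_none _ n) => [|//|i ni]; first by have := IH n (ltnSn n); lia.
  by have -> : i = n by lia.
have qn := Lq _ Ln.
rewrite /hits big_ord_recr/= asboolT// -/(hits L n) (@hits_none _ (n - q).+1).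
- by have := IH (n - q).+1 ltac:(lia); lia.
- by lia.
- by move=> i ni Li; have := Lsep _ _ Li Ln; lia.
Qed.

Lemma hits_runs P L (W : nat -> nat -> Prop) n N w :
  (forall i, i < n -> P i -> exists l, [/\ l < N, L l & W l i]) ->
  (forall l, hits (W l) n <= w) -> hits P n <= hits L N * w.
Proof.
move=> PW Ww.
apply: (@leq_trans (\sum_(l < N) hits (fun i => L l /\ W l i) n)).
  apply: (@hits_cover _ (fun l i => L l /\ W l i)) => i iP /PW -/(_ iP)[l [? ? ?]].
  by exists l.
rewrite [hits L N]/hits big_distrl/=; apply: leq_sum => l _.
case: (asboolP (L l)) => Ll.
  by rewrite mul1n (leq_trans _ (Ww l))// hits_le// => i _ [].
by rewrite mul0n /hits big1// => i _; rewrite asboolF// => -[].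
Qed.

End counting.

(** * Visits to closed sets *)

Section unit_mass.
Variable R : realType.
Local Notation mu := (@lebesgue_measure R).

Definition mass (A : set R) : R := fine (mu (A `&` `[0, 1[)).

Lemma itv01 : mu `[0, 1[%classic = 1%E.
Proof. by rewrite lebesgue_measure_itv/= lte01 oppr0 adde0. Qed.

Lemma massE (A : set R) : measurable A -> (mass A)%:E = mu (A `&` `[0, 1[).
Proof.
move=> mA; rewrite /mass fineK// ge0_fin_numE//.
apply: (@le_lt_trans _ _ (mu `[0, 1[%classic)); last by rewrite itv01 ltry.
by apply: le_measure; rewrite ?inE//; exact: measurableI.
Qed.

Lemma massC (A : set R) : measurable A -> mass (~` A) = 1 - mass A.
Proof.
move=> mA; apply: EFin_inj; rewrite EFinB !massE//; last exact: measurableC.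
rewrite -itv01 setIC -setDE measureD//=; last first.
  by rewrite itv01 ltry.
by rewrite setIC.
Qed.

End unit_mass.

Section equidistribution.
Variables (R : realType) (omega : R).
Hypothesis omega_irr : irrational omega.
Local Notation mu := (@lebesgue_measure R).

Definition visit (A : set R) (t : R) (i : nat) : Prop := A (t + i%:R * omega).

(** Multiplied by K, the distance to an integer is that of d to a multiple of K. *)
Lemma nearZ_fraction (K d : nat) : (0 < d < K)%N -> ~ nearZ (K%:R^-1) (d%:R / K%:R : R).
Proof.
move=> /andP[d0 dK] [m].
have K0 : 0 < K%:R :> R by rewrite ltr0n; lia.
rewrite -(ltr_pM2r K0) -{2}(gtr0_norm K0) -normrM mulrBl mulVf ?gt_eqF//.
rewrite divfK ?gt_eqF//.
rewrite (_ : d%:R - m%:~R * K%:R = (d%:Z - m * K%:Z)%:~R); last first.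
  by rewrite intrB intrM.
have dmK : d%:Z - m * K%:Z != 0.
  by apply/eqP => dmK; have [m0|m0] := lerP m 0; nia.
by apply/negP; rewrite -leNgt norm_intr_ge1 ?intr_int ?intr_eq0.
Qed.

Lemma hits_shift (P : nat -> Prop) n s :
  (hits P n <= hits (fun i => s <= i /\ P (i - s)) (n + s))%N.
Proof.
elim: n => [|n IH]; first by rewrite /hits big_ord0.
rewrite addSn /hits !big_ord_recr/= leq_add//.
by rewrite addnK asbool_and (asboolT (leq_addl _ _)).
Qed.

Lemma hits_disjoint (Q : nat -> nat -> Prop) K n :
  (forall i p p', (p < K)%N -> (p' < K)%N -> Q p i -> Q p' i -> p = p') ->
  (\sum_(p < K) hits (Q p) n <= n)%N.
Proof.
move=> Qd; rewrite /hits exchange_big/= -[leqRHS]card_ord -sum1_card.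
apply: leq_sum => i _.
have [[p Qp]|nQ] := pselect (exists p : 'I_K, Q p i); last first.
  by rewrite big1// => p _; rewrite asboolF// => Qp; apply: nQ; exists p.
rewrite (bigD1 p)//= big1 ?addn0 ?leq_b1// => p' p'p.
rewrite asboolF// => Qp'; move/eqP: p'p; apply; apply/val_inj.
exact: Qd Qp' Qp.
Qed.

(** The translates of A by multiples of omega close to 0, 1 / K, ...,
(K - 1) / K are pairwise disjoint, because A is shorter than their spacing.  Up
to a bounded shift of time each is visited as often as A, and together they are
visited at most once per unit of time. *)
Lemma short_arc_visits (K : nat) (A : set R) : (0 < K)%N ->
  (forall x y, A x -> A y -> nearZ (K.+1%:R^-1) (x - y)) ->
  exists T, forall n t, (hits (visit A t) n * K <= n + T)%N.
Proof.
move=> K0 Asmall; pose eta : R := (K%:R^-1 - K.+1%:R^-1) / 2.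
have eta0 : 0 < eta.
  by rewrite divr_gt0// subr_gt0 ltf_pV2 ?posrE ?ltr0n// ltr_nat.
have /choice[s sP] : forall p : nat, exists n : nat,
    nearZ eta (p%:R / K%:R - n%:R * omega).
  by move=> p; exact: orbit_dense.
have ssep p p' : (p < p' < K)%N ->
    ~ nearZ (K.+1%:R^-1) ((s p')%:R * omega - (s p)%:R * omega).
  move=> /andP[pp' p'K] near.
  have /nearZ_fraction : (0 < p' - p < K)%N by lia.
  apply; rewrite natrB ?(ltnW pp')//.
  have := nearZD near (nearZD (sP p') (nearZN (sP p))).
  rewrite (_ : _ + (eta + eta) = K%:R^-1); last first.
    by rewrite /eta; move: (K%:R^-1) (K.+1%:R^-1) => u v; lra.
  rewrite (_ : _ - _ + _ = (p'%:R - p%:R) / K%:R)//; ring.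
pose T := \max_(p < K) s p; exists T => n t.
have sT p : (p < K)%N -> (s p <= T)%N.
  by move=> pK; exact: (leq_bigmax (Ordinal pK)).
pose Q p i := (s p <= i)%N /\ visit A t (i - s p).
apply: leq_trans (@hits_disjoint Q K (n + T) _).
  rewrite mulnC -[X in (X * _)%N]card_ord -sum_nat_const; apply: leq_sum => p _.
  apply: leq_trans (hits_shift _ _ (s p)) _.
  rewrite -(subnKC (sT p (ltn_ord p))) addnA.
  rewrite /hits [leqRHS]big_split_ord/= leq_addr//.
have main i p p' : (p < p' < K)%N -> Q p i -> ~ Q p' i.
  move=> pp' [spi Ap] [sp'i Ap']; apply: (ssep _ _ pp').
  have := Asmall _ _ Ap Ap'; rewrite !natrB//.
  by rewrite (_ : _ - _ = (s p')%:R * omega - (s p)%:R * omega)//; ring.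
move=> i p p' pK p'K Qp Qp'; case: (ltngtP p p') => // pp'.
- by have := main i p p'; rewrite pp' p'K => /(_ isT Qp).
- by have := main i p' p; rewrite pp' pK => /(_ isT Qp').
Qed.

(** Continuity from above along the shrinking neighbourhoods of F. *)
Lemma mass_neighborhood (F : set R) e : closed F -> 0 < e ->
  exists K0, forall K, (K0 <= K)%N ->
  exists2 G : set R, measurable G /\ (mu G <= (mass F + e)%:E)%E
    & forall x y, 0 <= x < 1 -> F y -> `|x - y| < K.+1%:R^-1 -> G x.
Proof.
move=> cF e0.
pose U k := \bigcup_(y in F) ball y (k.+1%:R^-1 : R).
pose G k := U k `&` `[0, 1[%classic.
have mG k : measurable (G k).
  apply: measurableI => //; apply: open_measurable; apply: bigcup_open => y _.
  exact: ball_open.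
have UF : \bigcap_k G k = F `&` `[0, 1[%classic.
  apply/seteqP; split=> [x Gx|x [Fx x01] k _]; last first.
    by split=> //; exists x => //; apply: ballxx; rewrite invr_gt0.
  split; last by case: (Gx 0%N).
  apply: cF => B /nbhs_ballP[d /= d0 dB].
  have [[//|c] _ cd] := small_inv 0 d0.
  have [[y Fy yx] _] := Gx c I; exists y; split=> //; apply: dB.
  exact: ball_sym (le_ball cd yx).
have G0 : (mu (G 0%N) < +oo)%E.
  apply: (@le_lt_trans _ _ (mu `[0, 1[%classic)); last by rewrite itv01 ltry.
  by apply: le_measure; rewrite ?inE//; [exact: mG|move=> x []].
have Gdecr : {homo G : n m / (n <= m)%N >-> (m <= n)%O}.
  move=> n m nm; apply/subsetPset => x [[y Fy yx] x01]; split=> //; exists y => //.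
  by apply: le_ball yx; rewrite lef_pV2 ?posrE ?ltr0n// ler_nat.
have mF : measurable F by exact: closed_measurable.
have : (mu \o G) x @[x --> \oo] --> (mass F)%:E.
  rewrite massE// -UF; apply: nonincreasing_cvg_mu => //.
  by rewrite UF; apply: measurableI.
move=> /fine_cvgP[fin /cvgr_lt /(_ (mass F + e))].
rewrite ltrDl => /(_ e0) le; have [K0 _ K0P] := filterI fin le.
exists K0 => K K0K; exists (G K).
  split=> //; have [/= finK leK] := K0P K K0K.
  by rewrite -(fineK finK) lee_fin ltW.
move=> x y x01 Fy xy; split; last by rewrite /= in_itv.
by exists y => //; rewrite /ball/= distrC.
Qed.

(** Upper half of the unique ergodicity of the rotation.  Cut [0, 1) into
K + 1 cells: those meeting F have total length close to the mass of F by
mass_neighborhood, and each of them is visited with frequency at most 1 / K by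
short_arc_visits. *)
Lemma closed_visits (F : set R) e : closed F ->
  (forall x (m : int), F x -> F (x + m%:~R)) -> 0 < e ->
  exists N, forall n t, (N <= n)%N ->
    (hits (visit F t) n)%:R <= (mass F + e) * n%:R.
Proof.
move=> cF Fper e0.
have e4 : 0 < e / 4 by rewrite divr_gt0.
have [K0 K0P] := mass_neighborhood cF e4.
have [K K0K Ke] := small_inv K0 e4.
have {K0P}[G [mG muG] GP] := K0P K (ltnW K0K).
pose M := K.+1.
have M0 : 0 < M%:R :> R by rewrite ltr0n.
have K_gt0 : 0 < K%:R :> R by rewrite ltr0n; lia.
pose cell (j : nat) : set R := `[j%:R / M%:R, j.+1%:R / M%:R[%classic.
have cellP (j : nat) x : cell j x <-> j%:R <= M%:R * x < j.+1%:R.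
  by rewrite /cell/= in_itv/= ler_pdivrMr// ltr_pdivlMr// mulrC.
pose meets j := `[< exists2 x, F x & cell j x >].
pose c := (\sum_(j < M | meets j) 1)%N.
have cG : c%:R / M%:R <= mass F + e / 4.
  rewrite -lee_fin; apply: le_trans muG.
  have -> : (c%:R / M%:R)%:E = mu (\big[setU/set0]_(j < M | meets j) cell j).
    rewrite measure_bigsetU_ord_cond//.
    - rewrite (eq_bigr (fun=> (M%:R^-1)%:E)) => [|j _].
        rewrite sumEFin natr_sum mulr_suml; congr EFin.
        by apply: eq_bigr => *; rewrite mul1r.
      rewrite -[LHS]/(mu (cell j)) /cell lebesgue_measure_itv/= lte_fin.
      rewrite ltr_pM2r ?invr_gt0// ltr_nat ltnSn.
      by rewrite -EFinB -mulrBl -natrB// subSnn mul1r.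
    - by move=> j _; exact: measurable_itv.
    - move=> i j _ _ [x [/cellP/andP[ix xi] /cellP/andP[jx xj]]].
      have ij : (i < j.+1)%N by rewrite -(ltr_nat R) (le_lt_trans ix).
      have ji : (j < i.+1)%N by rewrite -(ltr_nat R) (le_lt_trans jx).
      by apply: val_inj => /=; lia.
  apply: le_measure; rewrite ?inE//.
    by apply: bigsetU_measurable => j _; exact: measurable_itv.
  elim/big_ind : _ => [x []|A B AG BG x [/AG|/BG]//|].
  move=> j /asboolP[y Fy /cellP yj] x /cellP xj.
  have jM : j.+1%:R <= M%:R :> R by rewrite ler_nat.
  have j0 : 0 <= j%:R :> R by [].
  apply: GP Fy _; first by rewrite -(pmulr_rge0 _ M0) -(ltr_pM2l M0) mulr1; lra.
  rewrite -(ltr_pM2l M0) mulfV ?gt_eqF// -{1}(gtr0_norm M0) -normrM mulrBr.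
  rewrite ltr_norml; rewrite -natr1 in xj yj.
  by move: (M%:R * _) (M%:R * _) xj yj => u v; lra.
pose J j : set R := [set x | exists2 m : int, True & cell j (x - m%:~R)].
have /choice[T TP] : forall j, exists T, forall n t,
    (hits (visit (J j) t) n * K <= n + T)%N.
  move=> j; apply: short_arc_visits; first by lia.
  move=> x y [m _ /cellP xm] [m' _ /cellP ym']; exists (m - m').
  rewrite -(ltr_pM2l M0) mulfV ?gt_eqF// -{1}(gtr0_norm M0) -normrM.
  have -> : M%:R * (x - y - (m - m')%:~R) = M%:R * (x - m%:~R) - M%:R * (y - m'%:~R).
    by rewrite intrB; ring.
  rewrite -natr1 in xm ym'; rewrite ltr_norml.
  by move: (M%:R * _) (M%:R * _) xm ym' => u v; lra.
pose T0 := \max_(j < M) T j.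
have FJ n t : (hits (visit F t) n * K <= c * (n + T0))%N.
  apply: (@leq_trans ((\sum_(j < M | meets j) hits (visit (J j) t) n) * K)).
    rewrite leq_mul2r; apply/orP; right; rewrite [leqRHS]big_mkcond/=.
    apply: leq_trans (@hits_cover _ (fun j i => meets j /\ visit (J j) t i) n M _) _.
      move=> i _ Fi; pose x := t + i%:R * omega; pose y := x - (Num.floor x)%:~R.
      have y01 : 0 <= y < 1.
        have /andP[] := floor_itv x; rewrite intrD /y => *; lra.
      have My : 0 <= M%:R * y by apply: mulr_ge0; lra.
      have yj : cell (Num.truncn (M%:R * y)) y by apply/cellP; exact: truncn_itv.
      exists (Num.truncn (M%:R * y)).
        by rewrite truncn_lt_nat// -[ltRHS]mulr1 ltr_pM2l//; lra.
      split; last by exists (Num.floor x).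
      by apply/asboolP; exists y => //; rewrite /y -intrN; exact: Fper.
    apply: leq_sum => j _; case: ifPn => [_|/negP nj].
      by apply: hits_le => i _ [].
    by rewrite /hits big1// => i _; rewrite asboolF// => -[].
  rewrite big_distrl/= /c big_distrl/=; apply: leq_sum => j _; rewrite mul1n.
  by apply: leq_trans (TP j n t) _; rewrite leq_add2l (leq_bigmax j).
have [N N0 Ne] := small_inv 0 e4.
exists (N * T0)%N => n t Nn.
have cM : c%:R <= M%:R :> R.
  rewrite ler_nat /c big_mkcond/= -[leqRHS]card_ord -sum1_card.
  by apply: leq_sum => j _; case: ifP.
have MK : M%:R = K%:R + 1 :> R by rewrite /M -natr1.
have K1 : 1 <= K%:R :> R by rewrite ler1n; lia.
have T0e : T0%:R <= e / 4 * n%:R.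
  apply: le_trans (_ : N%:R^-1 * n%:R <= _); last by rewrite ler_wpM2r.
  by rewrite ler_pdivlMl ?ltr0n// -natrM ler_nat.
have cK : c%:R / K%:R <= mass F + e / 2.
  have -> : c%:R / K%:R = c%:R / M%:R + c%:R / M%:R * K%:R^-1 :> R.
    by rewrite MK; field; lra.
  have : c%:R / M%:R * K%:R^-1 <= e / 4.
    apply: le_trans Ke; rewrite ler_piMl ?invr_ge0//.
    by rewrite ler_pdivrMr// mul1r.
  lra.
have cK2 : c%:R / K%:R <= 2 :> R.
  by rewrite ler_pdivrMr//; lra.
apply: (@le_trans _ _ (c%:R / K%:R * (n%:R + T0%:R))).
  rewrite mulrAC ler_pdivlMr// -natrD -!natrM ler_nat; exact: FJ.
rewrite mulrDr.
have : c%:R / K%:R * n%:R <= (mass F + e / 2) * n%:R by exact: ler_wpM2r.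
have : c%:R / K%:R * T0%:R <= 2 * T0%:R :> R by exact: ler_wpM2r.
lra.
Qed.

End equidistribution.

(** * Towers of arcs *)

Section arcs.
Variable R : realType.
Local Notation mu := (@lebesgue_measure R).
Implicit Types a b c t : R.

Definition arc a c : set R := [set x | nearZ a (x - c)].

Lemma arcE a c : arc a c = \bigcup_(m : int) ball (c + m%:~R) a.
Proof.
apply/seteqP; split=> x /= => [[m xm]|[m _]].
  by exists m => //; rewrite /ball/= distrC opprD addrA.
by rewrite /ball/= distrC opprD addrA; exists m.
Qed.

Lemma open_arc a c : open (arc a c).
Proof. by rewrite arcE; apply: bigcup_open => m _; exact: ball_open. Qed.

(** Only three integer translates of an interval of length 2 a can meet an
interval of length 1. *)
Lemma mu_arc a c t : 0 <= a <= 1 ->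
  (mu (arc a c `&` `[t, (t + 1)%R[) <= (6 * a)%:E)%E.
Proof.
move=> /andP[a0 a1]; pose f := Num.floor (t - c).
have /andP[f0 f1] := floor_itv (t - c); rewrite -/f intrD in f0 f1.
pose B (k : nat) : set R := ball (c + (f + k%:Z)%:~R) a.
have mB k : measurable (B k) by apply: open_measurable; exact: ball_open.
apply: (@le_trans _ _ (\sum_(k < 3) mu (B k))%E); last first.
  rewrite !big_ord_recl big_ord0 adde0 /=.
  by rewrite !lebesgue_measure_ball// -!EFinD lee_fin mulr2n; lra.
apply: content_subadditive; first by move=> k _; exact: mB.
  apply: measurableI => //; apply: open_measurable; exact: open_arc.
move=> x [[m xm]]; rewrite /= in_itv/= => /andP[tx xt].
have [fm mf] : (f <= m)%R /\ (m <= f + 2)%R.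
  move: xm; rewrite ltr_norml => /andP[xm mx]; split.
    by rewrite -ltzD1 -(ltr_int R) intrD; lra.
  by rewrite -ltzD1 -(ltr_int R) !intrD; lra.
rewrite -bigcup_mkord; exists `|m - f|%N; first by rewrite /=; lia.
rewrite /B /ball/=.
by rewrite distrC opprD addrA (_ : f + _ = m)//; lia.
Qed.

End arcs.

Section towers.
Variables (R : realType) (omega : R) (sc : scales omega).
Variables (w : nat -> nat) (z : nat -> nat -> int).
Hypothesis wS : forall k, (w k <= 2 ^ k * hgt sc k)%N.
Local Notation mu := (@lebesgue_measure R).

Definition tower k : set R := \bigcup_(p in [set p | (p < w k)%N])
  arc (rad sc k) ((z k p)%:~R * omega).

Lemma rad_gt0 k : 0 < rad sc k.
Proof. by rewrite invr_gt0 ltr0n (leq_trans _ (den_gt4 sc k)). Qed.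

Lemma rad_le1 k : rad sc k <= 1.
Proof.
have d0 := leq_trans (ltn0Sn 3) (ltnW (den_gt4 sc k)).
by rewrite -[rad sc k]/((den sc k)%:R^-1) invf_le1 ?ler1n ?ltr0n.
Qed.

Lemma rad_mono j k : (j <= k)%N -> rad sc k <= rad sc j.
Proof.
elim: k => [|k IH]; first by rewrite leqn0 => /eqP ->.
rewrite leq_eqVlt => /predU1P[-> //|]; rewrite ltnS => /IH; apply: le_trans.
by apply: le_trans (rad_half sc k) _; have := rad_gt0 k; lra.
Qed.

Lemma rho_mono j k : (j <= k)%N -> rho sc k <= rho sc j * 2^-1 ^+ (k - j).
Proof.
move=> jk; rewrite -{1}(subnKC jk); elim: (k - j)%N => [|d IH].
  by rewrite addn0 expr0 mulr1.
rewrite addnS exprSr mulrA; apply: le_trans (rho_half sc _) _.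
by apply: ler_wpM2r; rewrite ?invr_ge0.
Qed.

Lemma hgt_mono j k : (j <= k)%N -> (hgt sc j <= hgt sc k)%N.
Proof.
elim: k => [|k IH]; first by rewrite leqn0 => /eqP ->.
rewrite leq_eqVlt => /predU1P[-> //|]; rewrite ltnS => /IH /leq_trans; apply.
by apply: leq_trans (hgt_grow sc k); rewrite leq_pmull// expn_gt0.
Qed.

Lemma hgt_gtn k : (k < hgt sc k)%N.
Proof.
elim: k => [|k IH]; first exact: hgt_gt0.
apply: leq_trans (hgt_grow sc k); apply: leq_ltn_trans IH _.
by rewrite ltn_Pmull ?hgt_gt0// -[1%N](expn0 4) ltn_exp2l// addnS.
Qed.

Lemma open_tower k : open (tower k).
Proof. by apply: bigcup_open => p _; exact: open_arc. Qed.

Lemma tower_periodic k x (m : int) : tower k x -> tower k (x + m%:~R).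
Proof.
move=> [p pw xp]; exists p => //; rewrite /arc/= addrAC; exact/nearZ_int.
Qed.

(** The bound, up to a power of 2, for the measure of the tower of level k: it
must not fill the space that the earlier levels left between their arcs. *)
Definition room k : R := if k is k'.+1 then rho sc k' else 1.

Lemma room_decr j k : (j <= k)%N -> room k <= room j.
Proof.
have rho_le j' k' : (j' <= k')%N -> rho sc k' <= rho sc j'.
  move=> jk; apply: le_trans (rho_mono jk) _; rewrite ler_piMr ?(ltW (rho_gt0 _ _))//.
  by rewrite exprn_ile1 ?invr_ge0// invf_le1// ler1n.
case: j k => [|j] [|k]//=; last by move=> jk; apply: rho_le.
by move=> _; apply: le_trans (rho_le1 _ _) _; lra.
Qed.

Lemma mu_tower k t : (mu (tower k `&` `[t, (t + 1)%R[) <= (room k * 2^-1 ^+ k.+2)%:E)%E.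
Proof.
pose A p := arc (rad sc k) ((z k p)%:~R * omega) `&` `[t, (t + 1)%R[%classic.
have mA p : measurable (A p).
  by apply: measurableI => //; apply: open_measurable; exact: open_arc.
apply: (@le_trans _ _ (\sum_(p < w k) mu (A p))%E).
  apply: content_subadditive; first by move=> p _; exact: mA.
    by apply: measurableI => //; apply: open_measurable; exact: open_tower.
  move=> x [[p pw xp] xt]; rewrite -bigcup_mkord.
  by exists p.
apply: (@le_trans _ _ (\sum_(p < w k) (6 * rad sc k)%:E)%E).
  by apply: lee_sum => p _; apply: mu_arc; rewrite rad_le1 ltW// rad_gt0.
rewrite sumEFin lee_fin sumr_const card_ord.
rewrite (_ : (6 * rad sc k) *+ w k = 6 * ((w k)%:R * rad sc k)); last first.
  by rewrite -[LHS]mulr_natl; ring.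
apply: (@le_trans _ _ (6 * ((2 ^ k * hgt sc k)%:R * rad sc k))).
  by rewrite ler_pM2l// ler_pM2r ?rad_gt0// ler_nat.
case: k {A mA} => [|k] /=; last exact: massS.
by rewrite mul1r mul1n; exact: mass0.
Qed.

Lemma mu_tail K t :
  (mu (\bigcup_(k in [set k | (K <= k)%N]) tower k `&` `[t, (t + 1)%R[) <=
    (room K / 2)%:E)%E.
Proof.
have room_ge0 k : 0 <= room k by case: k => [|k] //=; exact/ltW/rho_gt0.
have mT k : measurable (tower k `&` `[t, (t + 1)%R[).
  by apply: measurableI => //; apply: open_measurable; exact: open_tower.
apply: (@le_trans _ _ (\sum_(0 <= i <oo) mu (tower (K + i)%N `&` `[t, (t + 1)%R[))%E).
  apply: measure_sigma_subadditive; first by move=> k; exact: mT.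
    apply: measurableI => //; apply: open_measurable; apply: bigcup_open => k _.
    exact: open_tower.
  move=> x [[k /= Kk xk] xt]; exists (k - K)%N => //.
  by rewrite subnKC.
have room2 : 0 <= room K / 2 by apply: divr_ge0.
apply: le_trans (epsilon_trick0 xpredT room2).
apply: lee_nneseries => // i _; apply: le_trans (mu_tower _ _) _.
rewrite lee_fin natrX -exprVn -mulrA ler_pM ?exprn_ge0 ?invr_ge0 ?room_decr ?leq_addr//.
by rewrite -exprS ler_wiXn2l ?invr_ge0 ?invf_le1 ?ler1n//; lia.
Qed.

End towers.

(** * Points covered by the towers *)

Section bad.
Variables (R : realType) (omega : R) (sc : scales omega).
Variables (w : nat -> nat) (z : nat -> nat -> int) (E : rel nat).
Hypothesis wS : forall k, (w k <= 2 ^ k * hgt sc k)%N.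
Hypothesis zS : forall k p, (p < w k)%N -> (`|z k p| <= 2 ^ k * hgt sc k)%N.
Local Notation mu := (@lebesgue_measure R).
Local Notation T := (tower sc w z).

(** For E the equality this is the union of all towers; for E the strict order
it is the set of the points that lie in at least two of them. *)
Definition bad : set R := [set x | exists j k, [/\ E j k, T j x & T k x]].

Lemma open_bad : open bad.
Proof.
rewrite (_ : bad = \bigcup_(jk in [set jk | E jk.1 jk.2]) (T jk.1 `&` T jk.2)).
  by apply: bigcup_open => -[j k] _; apply: openI; exact: open_tower.
apply/seteqP; split=> [x [j [k [Ejk xj xk]]]|x [[j k] Ejk [xj xk]]].
  by exists (j, k).
by exists j, k.
Qed.

Lemma bad_periodic x (m : int) : bad x -> bad (x + m%:~R).
Proof.
by move=> [j [k [Ejk xj xk]]]; exists j, k; split=> //; exact: tower_periodic.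
Qed.

Lemma good_periodic x (m : int) : (~` bad) x -> (~` bad) (x + m%:~R).
Proof. by move=> xg /(@bad_periodic _ (- m)); rewrite intrN addrK. Qed.

Lemma measurable_bad : measurable bad.
Proof. by apply: open_measurable; exact: open_bad. Qed.

Lemma bad_sub_tail : bad `<=` \bigcup_(k in [set k | (0 <= k)%N]) T k.
Proof. by move=> x [j [k [_ xj _]]]; exists j. Qed.

Lemma mass_good_gt0 : 0 < mass (~` bad).
Proof.
rewrite massC; last exact: measurable_bad.
rewrite subr_gt0; apply: (@le_lt_trans _ _ (1 / 2)); last by lra.
rewrite -lee_fin massE; last exact: measurable_bad.
have := @mu_tail _ _ sc w z wS 0 0; rewrite add0r; apply: le_trans.
apply: le_measure; rewrite ?inE.
- by apply: measurableI => //; exact: measurable_bad.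
- apply: measurableI => //; apply: open_measurable.
  by apply: bigcup_open => k _; exact: open_tower.
- by apply: setSI; exact: bad_sub_tail.
Qed.

Let towers_le K y x := forall k, (k <= K)%N -> T k y -> T k x.

(** If both sides fail, a left endpoint of an arc of level at most K lies
within rho K to the right of x, and a right endpoint within rho K to the left,
against rho_sep. *)
Lemma one_sided K x :
  (forall y, x <= y < x + rho sc K -> towers_le K y x) \/
  (forall y, x - rho sc K < y <= x -> towers_le K y x).
Proof.
apply: contrapT => /not_orP[].
move=> /existsNP[y /not_implyP[xy ny]] /existsNP[y' /not_implyP[yx ny']].
have {ny}[k [kK [p pw [m ym]] nx]] : exists k, [/\ (k <= K)%N, T k y & ~ T k x].
  by move: ny => /existsNP[k /not_implyP[? /not_implyP[? ?]]]; exists k.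
have {ny'}[k' [k'K [p' p'w [m' ym']] nx']] :
    exists k, [/\ (k <= K)%N, T k y' & ~ T k x].
  by move: ny' => /existsNP[k' /not_implyP[? /not_implyP[? ?]]]; exists k'.
have {nx}xm : rad sc k <= `|x - (z k p)%:~R * omega - m%:~R|.
  by rewrite leNgt; apply/negP => xm; apply: nx; exists p => //; exists m.
have {nx'}xm' : rad sc k' <= `|x - (z k' p')%:~R * omega - m'%:~R|.
  by rewrite leNgt; apply/negP => xm'; apply: nx'; exists p' => //; exists m'.
have zK i q : (i <= K)%N -> (q < w i)%N -> (`|z i q| <= 2 ^ K * hgt sc K)%N.
  move=> iK qw; apply: leq_trans (zS qw) _.
  by rewrite leq_mul ?hgt_mono// leq_pexp2l.
have := @rho_sep _ _ sc K k k' (z k p - z k' p') (m' - m) kK k'K.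
have := zK _ _ kK pw; have := zK _ _ k'K p'w => z1 z2.
move=> /(_ ltac:(lia)); apply/negP; rewrite -ltNge.
have e1 : x <= (z k p)%:~R * omega + m%:~R - rad sc k.
  move: ym xm; rewrite ltr_norml ler_normr.
  have := rad_gt0 sc k; lra.
have e2 : (z k' p')%:~R * omega + m'%:~R + rad sc k' <= x.
  move: ym' xm'; rewrite ltr_norml ler_normr.
  have := rad_gt0 sc k'; lra.
rewrite ltr_norml !intrB.
move: ym ym'; rewrite !ltr_norml; lra.
Qed.

Lemma rho_small e : 0 < e -> exists K, rho sc K <= e.
Proof.
move=> e0; have [[//|K] _ Ke] := small_inv 0 e0; exists K.+1; apply: le_trans Ke.
have := @rho_mono _ _ sc 0 K.+1 (leq0n _); rewrite subn0 => /le_trans; apply.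
apply: (@le_trans _ _ (2^-1 ^+ K.+1)).
  by rewrite ler_piMl ?exprn_ge0 ?invr_ge0//; apply: le_trans (rho_le1 _ _) _; lra.
by rewrite exprVn lef_pV2 ?posrE ?exprn_gt0 ?ltr0n// -natrX ler_nat ltnW// ltn_expl.
Qed.

(** On the side given by one_sided, every tower of level at most K that covers
a point also covers x; and the higher towers have measure less than rho K, so
they miss some point of that side.  Such a point lies in no more towers than x,
hence is good like x. *)
Lemma good_perfect x e : 0 < e -> (~` bad) x ->
  exists2 y, (~` bad) y & y != x /\ `|y - x| < e.
Proof.
move=> e0 xg; have [K Ke] := rho_small e0.
have rK := rho_gt0 sc K; have rK1 := rho_le1 sc K.
have good_of y : towers_le K y x ->
    ~ (\bigcup_(k in [set k | (K.+1 <= k)%N]) T k) y -> (~` bad) y.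
  move=> yx ny [j [k [Ejk yj yk]]]; apply: xg; exists j, k.
  have leK i : T i y -> (i <= K)%N.
    by move=> yi; rewrite leqNgt; apply/negP => Ki; apply: ny; exists i.
  by split=> //; apply: yx => //; exact: leK.
(* an interval of length rho K is too long to be covered by the high towers *)
have escape a b t : t <= a -> b <= t + 1 -> b - a = rho sc K ->
    exists2 y, a < y < b & ~ (\bigcup_(k in [set k | (K.+1 <= k)%N]) T k) y.
  move=> ta bt ba; apply: contrapT => nex.
  have : (mu `]a, b[%classic <= (rho sc K / 2)%:E)%E.
    apply: le_trans (@mu_tail _ _ sc w z wS K.+1 t); apply: le_measure; rewrite ?inE //.
      apply: measurableI => //; apply: open_measurable.
      by apply: bigcup_open => k _; exact: open_tower.
    move=> y; rewrite /= in_itv/= => yab; split; last first.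
      by rewrite /= in_itv/=; lra.
    by apply: contrapT => ny; apply: nex; exists y.
  rewrite lebesgue_measure_itv/= lte_fin -EFinB ba.
  have -> : a < b by lra.
  by rewrite lee_fin; lra.
have [side|side] := one_sided K x.
- have [y xy /good_of gy] := escape x (x + rho sc K) x ltac:(lra) ltac:(lra) ltac:(lra).
  exists y; first by apply: gy; apply: side; lra.
  split; first by apply/eqP; lra.
  by rewrite ltr_norml; lra.
- have [y xy /good_of gy] :=
    escape (x - rho sc K) x (x - rho sc K) ltac:(lra) ltac:(lra) ltac:(lra).
  exists y; first by apply: gy; apply: side; lra.
  split; first by apply/eqP; lra.
  by rewrite ltr_norml; lra.
Qed.

End bad.

(** * Visits of an orbit to the uncovered points *)

Section visits_to_good.
Variables (R : realType) (omega : R) (sc : scales omega).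
Hypothesis omega_irr : irrational omega.
Variables (w : nat -> nat) (z : nat -> nat -> int) (E : rel nat).
Local Notation mu := (@lebesgue_measure R).
Local Notation T := (tower sc w z).
Local Notation bad := (bad sc w z E).

(** The arc with its endpoints.  Quantifying over all larger radii makes
closedness immediate. *)
Definition closed_arc (a c : R) : set R :=
  [set x | forall b, a < b -> nearZ b (x - c)].

Lemma closed_closed_arc a c : closed (closed_arc a c).
Proof.
move=> x clx b ab; have ab2 : 0 < (b - a) / 2 by lra.
have [y [yc]] := clx _ (nbhsx_ballx x _ ab2); rewrite /ball/= => xy.
rewrite (_ : b = (a + b) / 2 + (b - a) / 2); last by lra.
have yc' := yc ((a + b) / 2) ltac:(lra).
rewrite (_ : x - c = y - c + (x - y)); last by ring.
by apply: nearZD => //; exists 0; rewrite subr0.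
Qed.

Definition closed_tower k : set R := \bigcup_(p in [set p | (p < w k)%N])
  closed_arc (rad sc k) ((z k p)%:~R * omega).

Lemma closed_closed_tower k : closed (closed_tower k).
Proof.
apply: closed_bigcup => [|p _]; first exact: finite_II.
exact: closed_closed_arc.
Qed.

Lemma tower_sub k : T k `<=` closed_tower k.
Proof.
by move=> x [p pw xp]; exists p => // b ab; apply: nearZ_le xp; exact: ltW.
Qed.

Definition closed_bad K : set R := \bigcup_(j in `I_K)
  \bigcup_(k in `I_K `&` [set k | E j k]) (closed_tower j `&` closed_tower k).

Lemma closed_closed_bad K : closed (closed_bad K).
Proof.
apply: closed_bigcup => [|j _]; first exact: finite_II.
apply: closed_bigcup => [|k _]; first exact/finite_setIl/finite_II.
by apply: closedI; exact: closed_closed_tower.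
Qed.

Lemma closed_bad_periodic K x (m : int) : closed_bad K x -> closed_bad K (x + m%:~R).
Proof.
have per k : closed_tower k x -> closed_tower k (x + m%:~R).
  by move=> [p pw xp]; exists p => // b /xp; rewrite addrAC => /nearZ_int; apply.
by move=> [j jK [k kK [xj xk]]]; exists j => //; exists k => //; split; exact: per.
Qed.

Lemma bad_sub K : bad `<=` closed_bad K `|` \bigcup_(k in [set k | (K <= k)%N]) T k.
Proof.
move=> x [j [k [Ejk xj xk]]].
have [Kj|jK] := leqP K j; first by right; exists j.
have [Kk|kK] := leqP K k; first by right; exists k.
by left; exists j => //; exists k => //; split; exact: tower_sub.
Qed.

Definition endpoints : set R := range (fun u : nat * nat * int * bool =>
  let: (k, p, m, b) := u in
  (z k p)%:~R * omega + (m%:~R + (if b then rad sc k else - rad sc k))).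

Lemma countable_endpoints : countable endpoints.
Proof. exact: sub_countable (card_image_le _ _) (countableP _). Qed.

Lemma closed_bad_sub K : closed_bad K `<=` bad `|` endpoints.
Proof.
have edge k x : closed_tower k x -> T k x \/ endpoints x.
  move=> [p pw xp].
  have [xT|xnT] := pselect (nearZ (rad sc k) (x - (z k p)%:~R * omega)).
    by left; exists p.
  right; have [m [xm|xm]] := nearZ_boundary xp xnT.
    by exists (k, p, m, true) => //; rewrite -xm addrC subrK.
  by exists (k, p, m, false) => //; rewrite -xm addrC subrK.
move=> x [j jK [k [kK Ejk] [/edge xj /edge xk]]].
case: xj => [xj|?]; last by right.
case: xk => [xk|?]; last by right.
by left; exists j, k.
Qed.

(** The two sets differ only by endpoints of arcs, which are countable. *)
Lemma mass_closed_bad K : mass (closed_bad K) <= mass bad.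
Proof.
have mC : measurable (closed_bad K).
  by apply: closed_measurable; exact: closed_closed_bad.
have mB : measurable bad by exact: measurable_bad.
have mE : measurable endpoints.
  apply: countable_measurable => [t|]; first exact: measurable_set1.
  exact: countable_endpoints.
rewrite -lee_fin !massE//.
apply: (@le_trans _ _ (mu ((bad `&` `[0, 1[%classic) `|` endpoints))).
  apply: le_measure; rewrite ?inE.
  - exact: measurableI.
  - by apply: measurableU => //; exact: measurableI.
  - by move=> x [/closed_bad_sub[xb|xe] x01]; [left|right].
apply: le_trans (measureU2 _ _ _) _ => //; first exact: measurableI.
rewrite [X in (_ + X)%E]countable_lebesgue_measure0 ?adde0//.
exact: countable_endpoints.
Qed.

(** A bad visit is a visit to closed_bad K, whose frequency is eventually at
most its mass, or a visit to a tower of level at least K. *)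
Lemma good_visits e : 0 < e -> exists K N, forall n t, (N <= n)%N ->
  (hits (visit omega (\bigcup_(k in [set k | (K <= k)%N]) T k) t) n)%:R <=
    2^-1 ^+ K * n%:R :> R ->
  (mass (~` bad) - e) * n%:R <= (hits (visit omega (~` bad) t) n)%:R.
Proof.
move=> e0; have e2 : 0 < e / 2 by lra.
have [[//|K] _ Ke] := small_inv 0 e2.
have {}Ke : 2^-1 ^+ K.+1 <= e / 2.
  apply: le_trans Ke; rewrite exprVn lef_pV2 ?posrE ?exprn_gt0// -natrX ler_nat.
  by rewrite ltnW// ltn_expl.
have [N NP] :=
  closed_visits omega_irr (@closed_closed_bad K.+1) (@closed_bad_periodic K.+1) e2.
exists K.+1, N => n t Nn tail.
rewrite -[hits (visit _ (~` _) _) _]/(hits (fun i => ~ visit omega bad t i) n).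
rewrite hitsC natrB ?hits_le_time// massC; last exact: measurable_bad.
suff : (hits (visit omega bad t) n)%:R <= (mass bad + e) * n%:R by lra.
apply: (@le_trans _ _ ((hits (visit omega (closed_bad K.+1) t) n)%:R +
    (hits (visit omega (\bigcup_(k in [set k | (K < k)%N]) T k) t) n)%:R)).
  rewrite -natrD ler_nat; apply: leq_trans (hitsU _ _ _); apply: hits_le => i _.
  exact: bad_sub.
have := NP n t Nn; have : 2^-1 ^+ K.+1 * n%:R <= e / 2 * n%:R by exact: ler_wpM2r.
have : mass (closed_bad K.+1) * n%:R <= mass bad * n%:R.
  by apply: ler_wpM2r => //; exact: mass_closed_bad.
by move: tail; lra.
Qed.

End visits_to_good.

(** * From periodic sets of reals to the circle *)

Section circle_sets.
Variable R : realType.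
Implicit Types (A : set R) (s t u v x y : R).
Local Notation proj := (@to_circle R).

Lemma to_circleP x y : (proj x = proj y) <-> exists m : int, x = y + m%:~R.
Proof.
split=> [/circle_eqP/intrP[m xym]|[m ->]].
  by exists m; rewrite -xym addrC subrK.
by apply/circle_eqP; rewrite addrAC subrr add0r intr_int.
Qed.

Lemma to_circle_surj (a : circle R) : exists x, proj x = a.
Proof. by exists (repr a); rewrite /to_circle reprK. Qed.

Lemma to_circle_inj x y : `|x - y| < 1 -> proj x = proj y -> x = y.
Proof.
move=> xy1 /to_circleP[m xym]; move: xy1; rewrite xym addrAC subrr add0r.
rewrite -intr_norm -[1]/(1%:~R) ltr_int => m1.
by rewrite (_ : m = 0) ?addr0//; lia.
Qed.

Lemma to_circle_shift x u : exists2 y, u <= y < u + 1 & proj y = proj x.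
Proof.
exists (x - (Num.floor (x - u))%:~R).
  by have /andP[] := floor_itv (x - u); rewrite intrD; lra.
by apply/to_circleP; exists (- Num.floor (x - u)); rewrite intrN.
Qed.

Lemma continuous_to_circle : continuous proj.
Proof. exact: pi_continuous. Qed.

Lemma open_circle (U : set (circle R)) : open (proj @^-1` U) -> open U.
Proof. by []. Qed.

Lemma open_to_circle_itv u v : open (proj @` `]u, v[%classic).
Proof.
apply: open_circle.
rewrite (_ : _ @^-1` _ = \bigcup_(m : int) `]u + m%:~R, v + m%:~R[%classic).
  by apply: bigcup_open => m _; exact: interval_open.
apply/seteqP; split=> [x [y yuv /to_circleP[m ymx]]|x [m _ xm]].
  exists (- m) => //; move: yuv; rewrite /= !in_itv/= ymx intrN; lra.
exists (x - m%:~R); first by move: xm; rewrite /= !in_itv/=; lra.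
by apply/to_circleP; exists (- m); rewrite intrN.
Qed.

Section periodic.
Variable A : set R.
Hypothesis Aper : forall x (m : int), A x -> A (x + m%:~R).
Local Notation C := (proj @` A).

Lemma to_circle_mem x : C (proj x) <-> A x.
Proof.
split=> [[y Ay /to_circleP[m ymx]]|Ax]; last by exists x.
by rewrite (_ : x = y + (- m)%:~R); [exact: Aper|rewrite intrN ymx; ring].
Qed.

Lemma preimage_to_circle : proj @^-1` C = A.
Proof. by apply/seteqP; split=> x /to_circle_mem. Qed.

Lemma circle_leb_image : circle_leb C = lebesgue_measure (A `&` `[0, 1[).
Proof. by rewrite /circle_leb /pushforward /mrestr preimage_to_circle. Qed.

Lemma compact_image : closed A -> compact C.
Proof.
move=> cA; rewrite (_ : C = proj @` (`[0, 1] `&` A)).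
  apply: continuous_compact.
    exact/continuous_subspaceT/continuous_to_circle.
  apply: compact_closedI => //; exact: segment_compact.
apply/seteqP; split=> [_ [x Ax <-]|_ [x [_ Ax] <-]]; last by exists x.
have [y y01 yx] := to_circle_shift x 0.
exists y => //; split; first by rewrite /= in_itv/=; lra.
by apply/to_circle_mem; rewrite yx; exists x.
Qed.

Lemma perfect_image :
  (forall x e, 0 < e -> A x -> exists2 y, A y & y != x /\ `|y - x| < e) ->
  isolated C = set0.
Proof.
move=> Aperf; apply/seteqP; split=> // a [/set_mem[x Ax <-] [V xV VC]].
have /nbhs_ballP[e /= e0 eV] := continuous_to_circle xV.
have [|y Ay [/eqP yx]] := Aperf x (Num.min e 1) _ Ax; first by rewrite lt_min e0 ltr01.
rewrite lt_min => /andP[ye y1].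
have /to_circle_inj-/(_ y1)// : [set proj x] (proj y).
rewrite -VC; split; last by exists y.
by apply: (eV y); rewrite /ball/= distrC.
Qed.

(** Two points u and v outside of A cut the circle into two open arcs that
separate given points s and t. *)
Lemma totally_disconnected_image :
  (forall x y, x < y -> exists2 u, x < u < y & ~ A u) ->
  totally_disconnected C.
Proof.
move=> Adense a [s As <-]; apply/seteqP; split; last first.
  by move=> _ ->; apply: connected_component_refl; exists s.
move=> b [B [Bs BC Bconn] Bb]; apply: contrapT => bs.
have [t0 t0b] := to_circle_surj b; have [t st tt0] := to_circle_shift t0 s.
rewrite t0b in tt0; rewrite -{b t0 t0b}tt0 in Bb bs *.
have {st}[st ts] : s < t /\ t < s + 1.
  split; last by lra.
  rewrite lt_neqAle; case/andP: st => -> _; rewrite andbT.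
  by apply/eqP => ?; apply: bs; subst t.
have [u su Au] := Adense _ _ st; have [v tv Av] := Adense _ _ ts.
pose W := proj @` `]u, v[%classic; pose W' := proj @` `]v, u + 1[%classic.
have WW' r : W r -> W' r -> False.
  move=> [x xuv <-] [y yvu] /esym/to_circle_inj; move: xuv yvu.
  rewrite /= !in_itv/= => xuv yvu; have -> : `|x - y| < 1 by rewrite ltr_norml; lra.
  by move=> /(_ isT); lra.
(* the arcs W and W' are complementary on C, so W is both open and closed in B *)
have BW : B `&` W = B.
  apply: Bconn.
  - exists (proj t); split=> //; exists t => //; rewrite /= in_itv/=; lra.
  - by exists W => //; exact: open_to_circle_itv.
  - exists (~` W'); first by apply: open_closedC; exact: open_to_circle_itv.
    apply/seteqP; split=> r [Br Wr]; split=> //; first by move=> ?; exact: WW' Wr _.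
    have [x0 x0r] := to_circle_surj r; have [x xu xx0] := to_circle_shift x0 u.
    move: (etrans xx0 x0r) => {x0 xx0 x0r} xr; subst r.
    have /to_circle_mem Ax := BC _ Br.
    have xnu : x != u by apply/eqP => ?; subst x.
    have xnv : x != v by apply/eqP => ?; subst x.
    exists x => //; rewrite /= in_itv/= lt_neqAle eq_sym xnu.
    case/andP: (xu) => -> xu1/=.
    rewrite lt_neqAle xnv leNgt /=; apply/negP => vx; apply: Wr; exists x => //.
    by rewrite /= in_itv/= vx.
have := Bs; rewrite -BW => -[_ Ws]; apply: WW' Ws _.
exists (s + 1); first by rewrite /= in_itv/=; lra.
by apply/to_circleP; exists 1.
Qed.

End periodic.
End circle_sets.

Section spectrum.
Variables (R : realType) (omega : R) (A : set R).
Hypothesis Aper : forall x (m : int), A x -> A (x + m%:~R).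
Local Notation proj := (@to_circle R).
Local Notation C := (proj @` A).

Lemma to_circle_orbit t i :
  proj t + (\pi_(circle R))%qT omega *+ i = proj (t + i%:R * omega).
Proof.
have piD x y : proj x + proj y = proj (x + y) by exact: circle_addE.
elim: i => [|i IH].
  by rewrite mulr0n addr0 mul0r addr0.
by rewrite mulrSr addrA IH -natr1 mulrDl mul1r addrA; exact: piD.
Qed.

Lemma birkhoff_avgE n t :
  birkhoff_avg omega C n (proj t) = n%:R^-1 * (hits (visit omega A t) n)%:R.
Proof.
rewrite /birkhoff_avg /hits natr_sum; congr (_ * _); apply: eq_bigr => i _.
rewrite indicE; congr (_%:R); congr nat_of_bool.
rewrite to_circle_orbit.
by apply/idP/idP => [/set_mem/(to_circle_mem Aper) ?|/asboolP ?];
  [apply/asboolP|apply/mem_set/(to_circle_mem Aper)].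
Qed.

(** The limit points of the averages hits P n / n, in a form free of
division. *)
Definition clusters (P : nat -> Prop) (c : R) := forall N e, 0 < e ->
  exists2 n, (N < n)%N & `|(hits P n)%:R - c * n%:R| < e * n%:R.

Lemma birkhoff_spectrumE :
  birkhoff_spectrum omega C = [set c | exists t, clusters (visit omega A t) c].
Proof.
have avgP n c e t : (0 < n)%N -> `|c - birkhoff_avg omega C n (proj t)| < e <->
    `|(hits (visit omega A t) n)%:R - c * n%:R| < e * n%:R.
  move=> n0; have n0R : 0 < n%:R :> R by rewrite ltr0n.
  rewrite birkhoff_avgE; set h := (hits _ _)%:R.
  rewrite (_ : h - c * n%:R = - ((c - n%:R^-1 * h) * n%:R)); last first.
    by field; rewrite gt_eqF.
  by rewrite normrN normrM (gtr0_norm n0R) ltr_pM2r.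
apply/seteqP; split=> c.
  move=> [a _ ac]; have [t ta] := to_circle_surj a; exists t => N e e0.
  have [x [[n /= Nn <-] cx]] := ac N.+1 isT _ (nbhsx_ballx c _ e0).
  exists n => //; apply/avgP; first exact: leq_ltn_trans Nn.
  by rewrite ta.
move=> [t tc]; exists (proj t) => // N _ B /nbhs_ballP[e /= e0 eB].
have [n Nn /avgP ne] := tc N e e0; exists (birkhoff_avg omega C n (proj t)); split.
  by exists n => //; exact: ltnW.
by apply: eB; apply: ne; exact: leq_ltn_trans Nn.
Qed.

End spectrum.

Section accumulation.
Variable R : realType.
Implicit Types (P : nat -> Prop) (c : R).

(** At time n the average moves by at most 1 / n, so on its way from below to
above c it cannot jump over a neighbourhood of c. *)
Lemma clusters_between P c :
  (forall N e, 0 < e -> exists2 n, (N < n)%N & (hits P n)%:R <= (c + e) * n%:R) ->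
  (forall N e, 0 < e -> exists2 n, (N < n)%N & (c - e) * n%:R <= (hits P n)%:R) ->
  clusters P c.
Proof.
move=> below above N e e0; have e2 : 0 < e / 2 by lra.
(* from time N1 on, one more visit changes the average by less than the width
   of the window around c *)
pose N1 := (N + (Num.truncn ((1 - c) / e)).+1)%N.
have N1P n : (N1 <= n)%N -> 1 - c <= e * n%:R.
  move=> N1n; rewrite -ler_pdivrMl// mulrC; apply: le_trans (ltW (truncnS_gt _)) _.
  by rewrite ler_nat; apply: leq_trans N1n; rewrite leq_addl.
have [n1 N1n1 n1P] := below N1 _ e2.
have [n2 n12 n2P] := above n1 _ e2.
pose Q n := (n1 <= n)%N && ((c - e / 2) * n%:R <= (hits P n)%:R).
have exQ : exists n, Q n by exists n2; rewrite /Q n2P ltnW.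
case: (ex_minnP exQ) => n /andP[n1n nP] nmin.
have n0 : 0 < n%:R :> R by rewrite ltr0n; lia.
exists n; first by rewrite /N1 in N1n1; lia.
have [nn1|nn1] := eqVneq n n1.
  rewrite nn1 in nP n0 *; rewrite ltr_norml; nra.
case: n n1n nn1 nP nmin n0 => [|n] n1n nn1 nP nmin n0; first by rewrite ltxx in n0.
have hn : (hits P n)%:R < (c - e / 2) * n%:R.
  rewrite ltNge; apply/negP => h; have := nmin n; rewrite /Q h andbT.
  move: n1n; rewrite leq_eqVlt eq_sym (negbTE nn1)/= ltnS => -> /(_ isT).
  by rewrite ltnn.
have hS : (hits P n.+1)%:R <= (hits P n)%:R + 1 :> R.
  by rewrite natr1 ler_nat /hits big_ord_recr/= -addn1 leq_add2l leq_b1.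
have := N1P n ltac:(lia).
have := mulr_ge0 (ltW e0) (ler0n R n).
rewrite ltr_norml -(natr1 n) in nP n0 *; move: hn hS nP.
set a := (hits P n)%:R; set b := (hits P n.+1)%:R.
move: a b (n%:R) => a b x; lra.
Qed.

End accumulation.

(** * Cantor sets obtained from towers *)

Section images.
Variables (R : realType) (omega : R) (sc : scales omega).
Hypothesis omega_irr : irrational omega.
Variables (w : nat -> nat) (z : nat -> nat -> int) (E : rel nat).
Hypothesis wS : forall k, (w k <= 2 ^ k * hgt sc k)%N.
Hypothesis zS : forall k p, (p < w k)%N -> (`|z k p| <= 2 ^ k * hgt sc k)%N.
Local Notation proj := (@to_circle R).
Local Notation good := (~` bad sc w z E).

Lemma closed_good : closed good.
Proof. by apply: open_closedC; exact: open_bad. Qed.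

Lemma circle_leb_good : circle_leb (proj @` good) = (mass good)%:E.
Proof.
rewrite circle_leb_image; last exact: good_periodic.
by rewrite massE//; apply: closed_measurable; exact: closed_good.
Qed.

Lemma good_nonempty : exists x, good x.
Proof.
apply: contrapT => /forallNP nog; have := mass_good_gt0 z E wS.
rewrite (_ : good = set0); last by apply/seteqP; split=> // x /nog.
by rewrite /mass set0I measure0 ltxx.
Qed.

Lemma cantor_good : (forall x y, x < y -> exists2 u, x < u < y & bad sc w z E u) ->
  cantor_set (proj @` good).
Proof.
have per := @good_periodic _ _ sc w z E.
move=> bad_dense; split.
- by have [x xg] := good_nonempty; exists (proj x), x.
- by apply: compact_image => //; exact: closed_good.
- apply: totally_disconnected_image => // x y /bad_dense[u xuy ub].
  by exists u => // ug; exact: ug ub.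
- by apply: perfect_image => // x e; exact: good_perfect.
Qed.

Lemma clusters_good_bounds t c : clusters (visit omega good t) c ->
  0 <= c <= mass good.
Proof.
move=> acc; apply/andP; split; apply/ler_addgt0Pr => e e0.
  have [n n0] := acc 0%N e e0; have nR : 0 < n%:R :> R by rewrite ltr0n.
  rewrite -(ler_pM2r nR) mul0r mulrDl ltr_norml.
  have : 0 <= (hits (visit omega good t) n)%:R :> R by [].
  by lra.
have e2 : 0 < e / 2 by lra.
have per := @good_periodic _ _ sc w z E.
have [N NP] := closed_visits omega_irr closed_good per e2.
have [n Nn] := acc N _ e2; have := NP n t (ltnW Nn).
have nR : 0 < n%:R :> R by rewrite ltr0n; lia.
rewrite -[in c <= _](ler_pM2r nR) ltr_norml.
by set h := (hits _ _)%:R; move: h (n%:R) => h x; lra.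
Qed.

(** The sum over k >= K of 2^-(k+3) is 2^-(K+2); the bound m on the levels that
occur makes the sum finite. *)
Lemma tail_visits (V : nat -> nat -> Prop) n m K :
  (forall i k, (i < n)%N -> V k i -> (k < m)%N) ->
  (forall k, hits (V k) n * 2 ^ (k + 3) <= n)%N ->
  (hits (fun i => exists2 k, (K <= k)%N & V k i) n)%:R <= 2^-1 ^+ (K + 2) * n%:R :> R.
Proof.
move=> Vm Vn; pose u k : R := if (K <= k)%N then 2^-1 ^+ (k + 3) else 0.
apply: (@le_trans _ _ (\sum_(k < m) u k * n%:R)).
  apply: le_trans (_ : (\sum_(k < m) hits (fun i => (K <= k)%N /\ V k i) n)%:R <= _).
    rewrite ler_nat.
    apply: (@hits_cover _ (fun k i => (K <= k)%N /\ V k i)) => i im [k Kk Vki].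
    by exists k => //; exact: Vm Vki.
  rewrite natr_sum; apply: ler_sum => k _; rewrite /u.
  case: ifPn => [Kk|nKk]; last first.
    by rewrite mul0r /hits big1// => i _; rewrite asboolF// => -[].
  rewrite exprVn ler_pdivlMl ?exprn_gt0// mulrC -natrX -natrM ler_nat.
  apply: leq_trans (Vn k); rewrite leq_mul2r; apply/orP; right.
  by apply: hits_le => i _ [].
rewrite -mulr_suml ler_wpM2r//.
suff : \sum_(k < m) u k <= 2^-1 ^+ (K + 2) - 2^-1 ^+ (maxn K m + 2).
  have : 0 <= 2^-1 ^+ (maxn K m + 2) :> R by rewrite exprn_ge0 ?invr_ge0.
  by lra.
elim: m {Vm} => [|m IH]; first by rewrite big_ord0 maxn0 subrr.
rewrite big_ord_recr/= /u; case: leqP => Km; last first.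
  by move: IH; rewrite !(maxn_idPl _) ?addr0// ltnW.
move: IH; rewrite !(maxn_idPr _)//; last exact: leqW.
rewrite !addnS addSn !exprS; set v := 2^-1 ^+ (m + 0); set v' := 2^-1 ^+ (K + 0).
by move: (\sum_(_ < _) _) v v' => s v v'; lra.
Qed.

End images.

(** * Forward towers: the full spectrum *)

Section full_spectrum.
Variables (R : realType) (omega : R) (sc : scales omega).
Hypothesis omega_irr : irrational omega.

Lemma rad_small e : 0 < e -> exists K, forall k, (K <= k)%N -> rad sc k <= e.
Proof.
have rad_le j k : (j <= k)%N -> rad sc k <= rad sc j * 2^-1 ^+ (k - j).
  move=> jk; rewrite -{1}(subnKC jk); elim: (k - j)%N => [|d IH].
    by rewrite addn0 expr0 mulr1.
  rewrite addnS exprSr mulrA; apply: le_trans (rad_half sc _) _.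
  by apply: ler_wpM2r; rewrite ?invr_ge0.
move=> e0; have [[//|K] _ Ke] := small_inv 0 e0; exists K.+1 => k Kk.
apply: le_trans Ke; have := rad_le 0%N k isT; rewrite subn0 => /le_trans; apply.
apply: (@le_trans _ _ (2^-1 ^+ k)).
  by rewrite ler_piMl ?rad_le1// exprn_ge0 ?invr_ge0.
rewrite exprVn lef_pV2 ?posrE ?exprn_gt0// -natrX ler_nat.
by apply: leq_trans Kk _; rewrite ltnW// ltn_expl.
Qed.

Definition forward_len k : nat := ((2 ^ k).-1 * hgt sc k)%N.
Definition forward_index k p : int := (hgt sc k + p)%:Z.
Local Notation T := (tower sc forward_len forward_index).

Definition forward_bad : set R := bad sc forward_len forward_index eq_op.
Local Notation good := (~` forward_bad).

Lemma forward_len_le k : (forward_len k <= 2 ^ k * hgt sc k)%N.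
Proof. by rewrite leq_mul// leq_pred. Qed.

Lemma forward_index_lt k p : (p < forward_len k)%N ->
  (`|forward_index k p| < 2 ^ k * hgt sc k)%N.
Proof.
rewrite absz_nat /forward_len; have : (0 < 2 ^ k)%N by rewrite expn_gt0.
by nia.
Qed.

Lemma forward_towerP k x : T k x <-> exists i : nat,
  (hgt sc k <= i < 2 ^ k * hgt sc k)%N /\ nearZ (rad sc k) (x - i%:R * omega).
Proof.
split=> [[p pw xp]|[i [/andP[hi ih] xi]]].
  exists (hgt sc k + p)%N; split=> //.
  by have := forward_index_lt pw; rewrite absz_nat leq_addr.
exists (i - hgt sc k)%N; last by rewrite /arc/= /forward_index subnKC.
rewrite /= /forward_len; have : (0 < 2 ^ k)%N by rewrite expn_gt0.
by nia.
Qed.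

(** The points n omega are dense, and (hgt (k + 1) + n) omega is close to
n omega, by hgt_near, while being the centre of a floor as soon as n is small
compared with hgt (k + 1). *)
Lemma forward_bad_dense x y : x < y -> exists2 u, x < u < y & forward_bad u.
Proof.
move=> xy; pose c := (x + y) / 2; pose e := (y - x) / 2.
have e2 : 0 < e / 2 by rewrite /e; lra.
have [n cn] := orbit_dense omega_irr c e2.
have [K KP] := rad_small e2.
pose k := maxn K n; pose i := (hgt sc k.+1 + n)%N.
have ci : nearZ e (c - i%:R * omega).
  have := nearZD cn (nearZN (hgt_near sc k)).
  rewrite (_ : _ - _ + _ = c - i%:R * omega); last by rewrite /i natrD; ring.
  apply: nearZ_le; have := KP k (leq_maxl _ _); have := rad_gt0 sc k.
  by rewrite /e; lra.
have [m cm] := ci; exists (i%:R * omega + m%:~R).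
  by move: cm; rewrite ltr_norml /c /e; lra.
have Ti : T k.+1 (i%:R * omega + m%:~R).
  apply/forward_towerP; exists i; split.
    rewrite leq_addr/=; have := hgt_gtn sc k.+1; have := leq_maxr K n.
    rewrite -/k => nk kh.
    rewrite /i expnS; have : (0 < 2 ^ k)%N by rewrite expn_gt0.
    by nia.
  by exists m; rewrite [_ + m%:~R]addrC addrK subrr normr0 rad_gt0.
by exists k.+1, k.+1; split=> //.
Qed.

Let V k := visit omega (T k) 0.

(** The orbit of 0 passes through the floor of index i first at time i, and
then after each return l to the neighbourhood of 0, all of which are late by
rad_return. *)
Lemma forward_visit_cases k i : V k i ->
  (hgt sc k <= i < 2 ^ k * hgt sc k)%N \/
  (exists l, [/\ (l <= i)%N, (4 ^ (k + 6) * hgt sc k < l)%N,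
    nearZ (rad sc k) (l%:R * omega) & (hgt sc k <= i - l < 2 ^ k * hgt sc k)%N]).
Proof.
have pow : (2 ^ k <= 4 ^ (k + 6))%N.
  apply: (@leq_trans (2 ^ (k + 6))); first by rewrite leq_pexp2l ?leq_addr.
  by rewrite leq_exp2r ?addnS.
have ret q : (0 < q)%N -> nearZ (rad sc k) (q%:R * omega) ->
    (4 ^ (k + 6) * hgt sc k < q)%N.
  move=> q0 qr; rewrite ltnNge; apply/negP => qh.
  apply: (@rad_return _ _ sc k q); first by rewrite q0.
  by apply: nearZ_le qr; have := rad_gt0 sc k; lra.
move=> /forward_towerP[i' [hi' ii']]; rewrite add0r -mulrBl in ii'.
have [ii|ii|ii] := ltngtP i i'.
- have /ret : (0 < i' - i)%N by lia.
  rewrite natrB ?(ltnW ii)// -opprB mulNr => /(_ (nearZN ii')) long.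
  by have := leq_mul pow (leqnn (hgt sc k)); lia.
- right; exists (i - i')%N; rewrite leq_subr subKn ?(ltnW ii)//; split=> //.
    by apply: ret; rewrite ?subn_gt0// natrB ?(ltnW ii).
  by rewrite natrB ?(ltnW ii).
- by left; rewrite ii.
Qed.

(** The first passage takes less than 2^k hgt k steps, which is small compared
with hgt (k + 1), and the later ones are 4^(k+6) hgt k steps apart. *)
Lemma forward_visits_few J k : (k < J)%N ->
  (hits (V k) (hgt sc J) * 2 ^ (k + 3) <= hgt sc J)%N.
Proof.
move=> kJ; set n := hgt sc J; set h := hgt sc k; set q := (4 ^ (k + 6) * h)%N.
have h0 : (0 < h)%N by exact: hgt_gt0.
have nh : (4 ^ (k + 3) * h <= n)%N.
  by apply: leq_trans (hgt_grow sc k) _; exact: hgt_mono.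
pose P i := (h <= i < 2 ^ k * h)%N.
pose L l := (q < l)%N /\ nearZ (rad sc k) (l%:R * omega).
pose Q i := exists l, [/\ (l < n)%N, L l & (l + h <= i < l + 2 ^ k * h)%N].
have VPQ : (hits (V k) n <= hits P n + hits Q n)%N.
  apply: leq_trans (hitsU _ _ _); apply: hits_le => i ni.
  case/forward_visit_cases => [?|[l [li ql lr lw]]].
    by left.
  right; exists l; split; [lia|by split|].
  by move: lw; rewrite -/h; move: (2 ^ k * h)%N => y; lia.
have Ph : (hits P n <= 2 ^ k * h - h)%N by exact: hits_interval.
have Lq : (hits L n * q <= n.-1)%N.
  apply: hits_separated; first by rewrite /q muln_gt0 expn_gt0.
    by move=> l [/ltnW].
  move=> l l' [_ lr] [_ l'r] ll'; rewrite leqNgt; apply/negP => lq.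
  apply: (@rad_return _ _ sc k (l' - l)); first by rewrite subn_gt0 ll' ltnW.
  rewrite natrB ?(ltnW ll')// mulrBl.
  rewrite (_ : 2 * rad sc k = rad sc k + rad sc k); last by ring.
  by apply: nearZD => //; exact: nearZN.
have Qw : (hits Q n <= hits L n * (2 ^ k * h - h))%N.
  apply: (@hits_runs _ _ (fun l i => (l + h <= i < l + 2 ^ k * h)%N)) => // l.
  apply: leq_trans (hits_interval _ _ _) _.
  by move: (2 ^ k * h)%N => y; lia.
have pow0 : (0 < 2 ^ k)%N by rewrite expn_gt0.
have pow4 : (4 ^ k = 2 ^ k * 2 ^ k)%N by rewrite -expnMn.
apply: leq_trans (_ : (2 ^ k * h + hits L n * (2 ^ k * h)) * 2 ^ (k + 3) <= n)%N.
  rewrite leq_mul2r; apply/orP; right; apply: leq_trans VPQ _; apply: leq_add.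
    exact: leq_trans Ph (leq_subr _ _).
  by apply: leq_trans Qw _; rewrite leq_mul2l leq_subr orbT.
move: nh Lq; rewrite /q !expnD pow4.
rewrite (_ : 2 ^ 3 = 8)%N// (_ : 4 ^ 3 = 64)%N// (_ : 4 ^ 6 = 4096)%N//.
move: (2 ^ k)%N pow0 (hits L n) => x x0 l nh Lq.
have : (x * h * (x * 8) * 2 <= n)%N by lia.
have : (l * (x * h) * (x * 8) * 2 <= n)%N by lia.
lia.
Qed.

Lemma forward_tail J K :
  (hits (visit omega (\bigcup_(k in [set k | (K <= k)%N]) T k) 0) (hgt sc J))%:R <=
    2^-1 ^+ K * (hgt sc J)%:R :> R.
Proof.
have VJ i k : (i < hgt sc J)%N -> V k i -> (k < J)%N.
  move=> iJ Vki; rewrite ltnNge; apply/negP => Jk; have := hgt_mono sc Jk.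
  case: (forward_visit_cases Vki) => [|[l [li ql _ _]]]; first by lia.
  have : (hgt sc k <= 4 ^ (k + 6) * hgt sc k)%N by rewrite leq_pmull ?expn_gt0.
  by lia.
pose V' k i := (k < J)%N /\ V k i.
apply: le_trans (_ : _ <= 2^-1 ^+ (K + 2) * (hgt sc J)%:R) _; last first.
  apply: ler_wpM2r => //; apply: ler_wiXn2l; rewrite ?invr_ge0 ?leq_addr//.
  by rewrite invf_le1 ?ler1n.
apply: le_trans (@tail_visits R V' (hgt sc J) J K _ _) => [|i k _ []//|k].
  rewrite ler_nat; apply: hits_le => i iJ [k Kk Vki]; exists k => //.
  by split=> //; exact: VJ Vki.
have [kJ|Jk] := ltnP k J.
  apply: leq_trans (forward_visits_few kJ); rewrite leq_mul2r; apply/orP; right.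
  by apply: hits_le => i _ [].
by rewrite /hits big1// => i _; rewrite asboolF// => -[]; rewrite ltnNge Jk.
Qed.

(** Up to time 2^q hgt q the orbit of 0 is bad except before time hgt q, so the
average is at most 2^-q; at the times hgt J it is close to the mass by
good_visits. *)
Lemma forward_clusters c : 0 <= c <= mass good -> clusters (visit omega good 0) c.
Proof.
move=> /andP[c0 cm]; apply: clusters_between => N e e0.
  have [q q0 qe] := small_inv N e0.
  exists (2 ^ q * hgt sc q)%N.
    apply: (leq_trans q0); apply: (leq_trans (ltnW (hgt_gtn sc q))).
    by rewrite leq_pmull ?expn_gt0.
  apply: (@le_trans _ _ (e * (2 ^ q * hgt sc q)%:R)); last by rewrite ler_wpM2r//; lra.
  apply: (@le_trans _ _ (hgt sc q)%:R).
    rewrite ler_nat; have := hits_interval 0 (hgt sc q) (2 ^ q * hgt sc q).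
    rewrite subn0; apply: leq_trans.
    apply: hits_le => i ih /= ig; rewrite ltnNge; apply/negP => hi; apply: ig.
    have Ti : T q (0 + i%:R * omega).
      apply/forward_towerP; exists i; rewrite hi ih; split=> //.
      by exists 0; rewrite add0r subrr subr0 normr0 rad_gt0.
    by exists q, q.
  have q0R : 0 < q%:R :> R by rewrite ltr0n; lia.
  have : q%:R^-1 * (2 ^ q * hgt sc q)%:R <= e * (2 ^ q * hgt sc q)%:R.
    exact: ler_wpM2r.
  apply: le_trans; rewrite ler_pdivlMl// -natrM ler_nat leq_mul2r.
  by rewrite (ltnW (ltn_expl _ _)) ?orbT.
have [K [M KMP]] := @good_visits _ _ sc omega_irr forward_len forward_index eq_op _ e0.
exists (hgt sc (maxn N M)).
  by apply: leq_ltn_trans (hgt_gtn sc _); exact: leq_maxl.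
apply: le_trans (KMP _ 0 _ (forward_tail _ _)).
  by apply: ler_wpM2r => //; lra.
by apply: leq_trans (ltnW (hgt_gtn sc _)); exact: leq_maxr.
Qed.

End full_spectrum.

(** * Backward towers: a gap at 0 *)

Section gap.
Variables (R : realType) (omega : R) (sc : scales omega).
Hypothesis omega_irr : irrational omega.
Local Notation h := (hgt sc).

Definition backward_index (k p : nat) : int := - p.+1%:Z.
Local Notation T := (tower sc h backward_index).

Definition backward_bad : set R := bad sc h backward_index ltn.
Local Notation good := (~` backward_bad).

Lemma backward_len_le k : (h k <= 2 ^ k * h k)%N.
Proof. by rewrite leq_pmull ?expn_gt0. Qed.

Lemma backward_index_le k p : (p < h k)%N -> (`|backward_index k p| <= 2 ^ k * h k)%N.
Proof. by move=> ph; rewrite abszN absz_nat (leq_trans ph) ?backward_len_le. Qed.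

Lemma backward_towerP k x : T k x <-> exists l : nat,
  (0 < l <= h k)%N /\ nearZ (rad sc k) (x + l%:R * omega).
Proof.
have zE p : x - (backward_index k p)%:~R * omega = x + p.+1%:R * omega.
  by rewrite /backward_index intrN mulNr opprK.
split=> [[p pw xp]|[[|p] [// ph xp]]].
  by exists p.+1; rewrite -zE.
by exists p => //; rewrite /arc/= zE.
Qed.

(** The point -n omega is the centre of a floor of every level k with
hgt k >= n. *)
Lemma backward_bad_dense x y : x < y -> exists2 u, x < u < y & backward_bad u.
Proof.
move=> xy; pose e := (y - x) / 2.
have e0 : 0 < e by rewrite /e; lra.
have [n [m nm]] := orbit_dense omega_irr (- ((x + y) / 2) - omega) e0.
pose i := n.+1; exists (- (i%:R * omega) - m%:~R).
  by move: nm; rewrite /i -(natr1 n) ltr_norml /e; lra.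
have Tk k : (n < k)%N -> T k (- (i%:R * omega) - m%:~R).
  move=> nk; apply/backward_towerP; exists i; split.
    by apply: leq_trans nk _; exact: ltnW (hgt_gtn sc k).
  exists (- m); rewrite [X in `|X|](_ : _ = 0) ?normr0 ?rad_gt0//.
  by rewrite intrN; ring.
by exists n.+1, n.+2; split; rewrite //=; apply: Tk.
Qed.

Definition return_time k : nat := (4 ^ (k + 6) * h k)%N.
(** The time i belongs to a run of level k ending at time i + l; this end comes
no earlier than return_time k. *)
Definition delayed k t i := exists l, [/\ (0 < l <= h k)%N, (return_time k <= i + l)%N &
  nearZ (rad sc k) (t + (i + l)%:R * omega)].

Lemma close_returns k t l l' : (l < l')%N ->
  nearZ (rad sc k) (t + l%:R * omega) -> nearZ (rad sc k) (t + l'%:R * omega) ->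
  (return_time k <= l' - l)%N.
Proof.
move=> ll' lr l'r; rewrite leqNgt; apply/negP => lq.
apply: (@rad_return _ _ sc k (l' - l)); first by rewrite subn_gt0 ll' ltnW.
rewrite natrB ?(ltnW ll')// (_ : 2 * rad sc k = rad sc k + rad sc k); last by ring.
rewrite (_ : (_ - _) * _ = (t + l'%:R * omega) - (t + l%:R * omega)); last by ring.
by apply: nearZD => //; exact: nearZN.
Qed.

Lemma return_time_gt k : (k + h k < return_time k)%N.
Proof.
have := hgt_gtn sc k; rewrite /return_time expnD (_ : 4 ^ 6 = 4096)%N//.
have : (0 < 4 ^ k)%N by rewrite expn_gt0.
by nia.
Qed.

(** The ends of delayed runs are return_time k apart and the first of them does
not come earlier, so they have density at most 1 / return_time k from the start;
each run has length hgt k. *)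
Lemma delayed_hits_few k t n : (hits (delayed k t) n * 2 ^ (k + 3) <= n)%N.
Proof.
pose L l := (return_time k <= l)%N /\ nearZ (rad sc k) (t + l%:R * omega).
set q := return_time k.
have h0 : (0 < h k)%N by exact: hgt_gt0.
have Lq N : (hits L N * q <= N.-1)%N.
  apply: hits_separated; first by rewrite /q /return_time muln_gt0 expn_gt0.
    by move=> l [].
  by move=> l l' [_ lr] [_ l'r] ll'; exact: close_returns lr l'r.
have Pw : (hits (delayed k t) n <= hits L (n + h k) * h k)%N.
  apply: (@hits_runs _ _ (fun l i => (l - h k <= i < l)%N)) => [i ni [l [lh ql lr]]|l].
    by exists (i + l)%N; split=> //; lia.
  by apply: leq_trans (hits_interval _ _ _) _; lia.
have pow0 : (0 < 2 ^ k)%N by rewrite expn_gt0.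
have pow4 : (4 ^ k = 2 ^ k * 2 ^ k)%N by rewrite -expnMn.
have qE : q = (2 ^ k * 2 ^ k * 4096 * h k)%N by rewrite /q /return_time expnD pow4.
apply: (@leq_trans (hits L (n + h k) * h k * 2 ^ (k + 3))).
  by rewrite leq_mul2r Pw orbT.
move: (Lq (n + h k)%N); rewrite qE expnD (_ : 2 ^ 3 = 8)%N//.
move: (2 ^ k)%N pow0 (hits L _) {pow4 qE Pw Lq} => x x0 [//|l] lq.
have : (h k <= n)%N.
  have : (1 * (1 * 1 * 4096 * h k) <= l.+1 * (x * x * 4096 * h k))%N.
    by rewrite !leq_mul.
  by lia.
have : (l.+1 * h k * (x * 8) * 2 <= l.+1 * (x * x * 4096 * h k))%N by nia.
by lia.
Qed.

Lemma delayed_index_lt k t i n : (i < n)%N -> delayed k t i -> (k < n)%N.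
Proof. by move=> ni [l [lh ql _]]; have := return_time_gt k; lia. Qed.

Lemma delayed_tail K t n :
  (hits (fun i => exists2 k, (K <= k)%N & delayed k t i) n)%:R <=
    2^-1 ^+ (K + 2) * n%:R :> R.
Proof.
apply: (@tail_visits R (fun k => delayed k t) n n) => [i k|k].
  exact: delayed_index_lt.
exact: delayed_hits_few.
Qed.

(** The orbit of 0 starts at the end of a run, so all its later runs are
delayed. *)
Lemma backward_tail K n :
  (hits (visit omega (\bigcup_(k in [set k | (K <= k)%N]) T k) 0) n)%:R <=
    2^-1 ^+ K * n%:R :> R.
Proof.
apply: le_trans (_ : _ <= 2^-1 ^+ (K + 2) * n%:R) _; last first.
  apply: ler_wpM2r => //; apply: ler_wiXn2l; rewrite ?invr_ge0 ?leq_addr//.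
  by rewrite invf_le1 ?ler1n.
apply: le_trans (delayed_tail K 0 n).
rewrite ler_nat; apply: hits_le => i ni [k Kk /backward_towerP[l [lh xl]]].
exists k => //.
rewrite add0r -mulrDl -natrD in xl.
exists l; split=> //; last by rewrite add0r.
rewrite leqNgt; apply/negP => lq.
apply: (@rad_return _ _ sc k (i + l)); first by apply/andP; split; [lia|exact: ltnW].
by apply: nearZ_le xl; have := rad_gt0 sc k; lra.
Qed.

Lemma backward_clusters_mass : clusters (visit omega good 0) (mass good).
Proof.
apply: clusters_between => N e e0.
  have per := @good_periodic _ _ sc h backward_index ltn.
  have cg := @closed_good _ _ sc h backward_index ltn.
  have [M MP] := closed_visits omega_irr cg per e0.
  by exists (N + M).+1; [rewrite ltnS leq_addr|apply: MP; rewrite leqW ?leq_addl].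
have [K [M KMP]] := @good_visits _ _ sc omega_irr h backward_index ltn _ e0.
exists (N + M).+1; first by rewrite ltnS leq_addr.
by apply: KMP (backward_tail _ _); rewrite leqW ?leq_addl.
Qed.

Lemma clusters_bad t (c : R) : (forall i, visit omega backward_bad t i) ->
  clusters (visit omega good t) c <-> c = 0.
Proof.
move=> tbad; have h0 n : hits (visit omega good t) n = 0%N.
  by rewrite /hits big1// => i _; rewrite asboolF// => /(_ (tbad i)).
split=> [acc|-> N e e0].
  apply/eqP; rewrite -normr_le0; apply/ler_addgt0Pr => e e0; rewrite add0r.
  have [n n0] := acc 0%N e e0; rewrite h0 sub0r normrN normrM normr_nat.
  by rewrite ltr_pM2r ?ltr0n// => /ltW.
by exists N.+1 => //; rewrite h0 mul0r subrr normr0 mulr_gt0 ?ltr0n.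
Qed.

(** First case: runs of arbitrarily long duration are in progress at time 0.
Once such a run of level k1 covers time i, one ending later than hgt k1 has
another level and also covers i, so every i is bad.  Second case: the runs in
progress at time 0 end before some common time M.  If i >= M is in runs of levels
j < k, the run of level k started after time 0, within rad j of 0 by hgt_near, so
the run of level j is delayed.  Up to M visits, the bad visits thus have density
at most 1 / 4 by delayed_tail. *)
Lemma backward_gap t (c : R) : clusters (visit omega good t) c -> c = 0 \/ 1 / 2 <= c.
Proof.
move=> acc.
have [alltime|/existsNP[M nM]] := pselect (forall M, exists k l : nat,
    [/\ (M <= l)%N, (l <= h k)%N & nearZ (rad sc k) (t + l%:R * omega)]).
  left; suff tbad i : visit omega backward_bad t i by apply/(clusters_bad c tbad).
  have [k1 [l1 [il1 l1h near1]]] := alltime i.+1.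
  have [k2 [l2 [il2 l2h near2]]] := alltime (maxn i (h k1)).+1.
  have Ti k l : (i < l)%N -> (l <= h k)%N -> nearZ (rad sc k) (t + l%:R * omega) ->
      T k (t + i%:R * omega).
    move=> il lh near; apply/backward_towerP; exists (l - i)%N; split; first by lia.
    by rewrite -addrA -mulrDl -natrD subnKC// ltnW.
  have k12 : (k1 < k2)%N.
    by rewrite ltnNge; apply/negP => /(hgt_mono sc); lia.
  exists k1, k2; split=> //; first exact: Ti near1.
  by apply: Ti near2 => //; lia.
right.
have far k l : (M <= l)%N -> nearZ (rad sc k) (t + l%:R * omega) -> (h k < l)%N.
  by move=> Ml near; rewrite ltnNge; apply/negP => lh; apply: nM; exists k, l.
pose D i := exists2 k, (0 <= k)%N & delayed k t i.
have badP i : visit omega backward_bad t i -> (i < M)%N \/ D i.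
  move=> [j [k [jk /backward_towerP[l [lh li]] /backward_towerP[l' [l'h l'i]]]]].
  rewrite -addrA -mulrDl -natrD in li; rewrite -addrA -mulrDl -natrD in l'i.
  have [iM|Mi] := ltnP i M; [by left|right].
  exists j => //; exists l; split=> //.
  have hl' := far _ _ (leq_trans Mi (leq_addr _ _)) l'i.
  (* where the run of level k ending at i + l' starts *)
  have start : nearZ (rad sc j) (t + (i + l' - h k)%:R * omega).
    case: k jk l'h l'i hl' => // k jk l'h l'i hl'.
    have := nearZD l'i (nearZN (hgt_near sc k)).
    rewrite natrB ?(ltnW hl')//.
    rewrite (_ : _ + _ - _ = t + ((i + l')%:R - (h k.+1)%:R) * omega); last by ring.
    apply: nearZ_le; have := rad_mono sc (jk : (j <= k)%N).
    have := rad_half sc k; lra.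
  by have := close_returns _ start li; lia.
rewrite leNgt; apply/negP => c2.
have [n nM'] := acc (4 * M)%N ((1 / 2 - c) / 2) ltac:(lra).
have : (hits (visit omega backward_bad t) n <= M + hits D n)%N.
  apply: (@leq_trans (hits (fun i => (0 <= i < M)%N) n + hits D n)).
    by apply: leq_trans (hitsU _ _ _); apply: hits_le => i _ /badP.
  by rewrite leq_add2r; apply: leq_trans (hits_interval _ _ _) _; rewrite subn0.
rewrite -(ler_nat R) natrD; have := delayed_tail 0 t n.
rewrite -[hits (visit _ good _) _]/(hits (fun i => ~ visit omega backward_bad t i) n).
rewrite hitsC natrB ?hits_le_time// ltr_norml.
have : 4 * M%:R < n%:R :> R by rewrite -natrM ltr_nat.
move: (hits _ _)%:R (hits (visit _ _ _) _)%:R => a b.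
rewrite add0n expr2; move: (M%:R : R) (n%:R : R) => m x; nra.
Qed.

(** Baire: for each i, the points t with t + i omega bad form a dense open
set. *)
Lemma avoiding_orbit : exists t, forall i, visit omega backward_bad t i.
Proof.
pose F i : set R := (fun t => t + i%:R * omega) @^-1` backward_bad.
have [|||t [_ tF]] := @Baire R R F _ setT; last by exists t => i; exact: tF i I.
- move=> i; split.
    apply: open_comp; last exact: open_bad.
    by move=> t _; apply: cvgD => //; exact: cvg_cst.
  move=> O [x Ox] oO; have /nbhs_ballP[e /= e0 eO] := open_nbhs_nbhs (conj oO Ox).
  have [u xu bu] :=
    @backward_bad_dense (x + i%:R * omega) (x + i%:R * omega + e) ltac:(lra).
  exists (u - i%:R * omega); split; last by rewrite /F/= subrK.
  by apply: eO; rewrite /ball/= ltr_norml; lra.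
- by exists 0.
- exact: openT.
Qed.

End gap.

Theorem corollary3 (R : realType) (omega : R) (omega_irr : irrational omega) :
  exists C C' : set (circle R),
    [/\ cantor_set C /\ cantor_set C',
        (0 < circle_leb C)%E /\ (0 < circle_leb C')%E,
        birkhoff_spectrum omega C = `[0, fine (circle_leb C)]%classic,
        isolated (birkhoff_spectrum omega C') 0 &
        [set 0; fine (circle_leb C')] `<=` birkhoff_spectrum omega C' /\
        birkhoff_spectrum omega C' `<` `[0, fine (circle_leb C')]%classic].
Proof.
have [sc] := scales_exist omega_irr.
pose A1 := ~` forward_bad sc; pose A2 := ~` backward_bad sc.
exists (@to_circle R @` A1), (@to_circle R @` A2).
have len1 := forward_len_le sc; have len2 := backward_len_le sc.
have leb1 : circle_leb (@to_circle R @` A1) = (mass A1)%:E by exact: circle_leb_good.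
have leb2 : circle_leb (@to_circle R @` A2) = (mass A2)%:E by exact: circle_leb_good.
have m1 : 0 < mass A1 by exact: mass_good_gt0.
have m2 : 0 < mass A2 by exact: mass_good_gt0.
have per1 : forall x (m : int), A1 x -> A1 (x + m%:~R) by exact: good_periodic.
have per2 : forall x (m : int), A2 x -> A2 (x + m%:~R) by exact: good_periodic.
rewrite leb1 leb2 !lte_fin /= !birkhoff_spectrumE//.
set S2 := [set c | exists t, clusters (visit omega A2 t) c].
have S2_mass : S2 (mass A2) by exists 0; exact: backward_clusters_mass.
have S2_0 : S2 0.
  have [t tbad] := avoiding_orbit sc omega_irr.
  by exists t; apply/(clusters_bad 0 tbad).
have S2_gap c : S2 c -> c = 0 \/ 1 / 2 <= c by move=> [t /backward_gap].
split=> //.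
- split; apply: cantor_good => //.
  + by move=> k p pk; exact: ltnW (forward_index_lt pk).
  + exact: forward_bad_dense.
  + exact: backward_index_le.
  + exact: backward_bad_dense.
- apply/seteqP; split=> c.
    by move=> [t /(clusters_good_bounds omega_irr) cm]; rewrite /= in_itv.
  by rewrite /= in_itv/= => cm; exists 0; exact: forward_clusters.
- split; first by rewrite inE.
  exists (ball 0 (1 / 2)); first by apply: nbhsx_ballx; lra.
  apply/seteqP; split=> [c [c2 /S2_gap[-> //|]]|_ ->].
    by move: c2; rewrite /ball/= sub0r normrN => /ltr_normlW; lra.
  by split=> //; apply: ballxx; lra.
- split; first by move=> c [->|->].
  split=> [c [t /(clusters_good_bounds omega_irr) cm]|sub].
    by rewrite /= in_itv.
  have m2' : 1 / 2 <= mass A2 by case: (S2_gap _ S2_mass) => // m0; lra.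
  have /S2_gap[|] : S2 (1 / 4) by apply: sub; rewrite /= in_itv/=; lra.
    by lra.
  by lra.
Qed.
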